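(* Let $T$ be a consistent recursively enumerable theory in the language of arithmetic with $T\supseteq \mathsf{Q}$. Then there exist a consistent recursively enumerable theory $U\supseteq T$ and a number $u\in\mathbb{N}$ such that $$\mathcal{W}_u=\{n\in\mathbb{N}\mid U\vdash \text{``}\varphi_n(n)\!\uparrow\text{''}\}$$ and $U\vdash \text{``}\varphi_u(u)\!\downarrow\text{''}$ (while in fact $\varphi_u(u)\!\uparrow$).
   Context: $\varphi_0,\varphi_1,\varphi_2,\dots$ is a standard acceptable enumeration of all unary partial recursive functions, and $\mathcal{W}_i$ denotes the domain of $\varphi_i$. $\varphi_i(j)\!\downarrow$ means $j\in\mathcal{W}_i$, and $\varphi_i(j)\!\uparrow$ means $j\notin\mathcal{W}_i$. The quoted formulas $\text{``}\varphi_n(n)\!\downarrow\text{''}$ and $\text{``}\varphi_n(n)\!\uparrow\text{''}$ are the natural arithmetical formalizations of these statements. The first is a $\Sigma_1$-sentence and the second is its negation. $\mathsf{Q}$ is Robinson's arithmetic. *)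

(* Defs.v *)
From mathcomp Require Import all_boot.

Set Implicit Arguments.
Unset Strict Implicit.
Unset Printing Implicit Defensive.

(* [recf n]: definitions of n-ary partial recursive functions.
   [RPrec f g] recurses on the first argument:
     h(0, v) = f(v),   h(k+1, v) = g(k, h(k, v), v);
   [RMin f] is v |-> (mu y. f(y, v) = 0). *)
Inductive recf : nat -> Type :=
| RZero n : recf n
| RSucc : recf 1
| RProj n (i : 'I_n) : recf n
| RComp n m (f : recf m) (gs : 'I_m -> recf n) : recf n
| RPrec n (f : recf n) (g : recf n.+2) : recf n.+1
| RMin n (f : recf n.+1) : recf n.

Fixpoint prec_graph (base : nat -> Prop) (step : nat -> nat -> nat -> Prop)
    (k y : nat) : Prop :=
  if k is k'.+1 then exists z, prec_graph base step k' z /\ step k' z y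
  else base y.

(* [eval f v y]: the partial function f is defined at v, with value y. *)
Fixpoint eval n (f : recf n) : n.-tuple nat -> nat -> Prop :=
  match f in recf n return n.-tuple nat -> nat -> Prop with
  | RZero _ => fun _ y => y = 0
  | RSucc => fun v y => y = (thead v).+1
  | RProj _ i => fun v y => y = tnth v i
  | RComp _ m f gs => fun v y =>
      exists w : m.-tuple nat,
        (forall i, eval (gs i) v (tnth w i)) /\ eval f w y
  | RPrec _ f g => fun v y =>
      let p := behead_tuple v in
      prec_graph (eval f p) (fun k z => eval g (cons_tuple k (cons_tuple z p)))
        (thead v) y
  | RMin _ f => fun v y =>
      eval f (cons_tuple y v) 0 /\
      (forall z, z < y -> exists k, eval f (cons_tuple z v) k.+1)
  end.

Definition re (A : nat -> Prop) : Prop :=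
  exists f : recf 1, forall n, A n <-> exists y, eval f [tuple n] y.

(* An enumeration of unary partial functions is presented by a definition [e]
   of its universal function (i, x) |-> phi_i(x). *)
Definition phi (e : recf 2) (i x y : nat) : Prop := eval e [tuple i; x] y.

Definition W (e : recf 2) (i x : nat) : Prop := exists y, phi e i x y.

(* Rogers' acceptability: the universal function is partial recursive (which
   is built in), and every partial recursive f(i, x) is phi_{s(i)}(x) for some
   total recursive s (the s-m-n property).  Taking f independent of i, every
   unary partial recursive function occurs among the phi_j. *)
Definition acceptable (e : recf 2) : Prop :=
  forall f : recf 2, exists s : recf 1, forall i, exists j,
    eval s [tuple i] j /\
    (forall x y, phi e j x y <-> eval f [tuple i; x] y).

Inductive term : Type :=
| Var of nat
| Zero
| Succ of term
| Add of term & term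
| Mul of term & term.

(* De Bruijn syntax: [All] binds variable 0. *)
Inductive form : Type :=
| Bot
| Eq of term & term
| Imp of form & form
| All of form.

Fixpoint tsubst (s : nat -> term) (t : term) : term :=
  match t with
  | Var n => s n
  | Zero => Zero
  | Succ t => Succ (tsubst s t)
  | Add t u => Add (tsubst s t) (tsubst s u)
  | Mul t u => Mul (tsubst s t) (tsubst s u)
  end.

Definition shift (k : nat) : term -> term := tsubst (fun n => Var (k + n)).

Definition up (s : nat -> term) (n : nat) : term :=
  if n is n'.+1 then shift 1 (s n') else Var 0.

Fixpoint subst (s : nat -> term) (A : form) : form :=
  match A with
  | Bot => Bot
  | Eq t u => Eq (tsubst s t) (tsubst s u)
  | Imp A B => Imp (subst s A) (subst s B)
  | All A => All (subst (up s) A)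
  end.

Definition inst (A : form) (t : term) : form :=
  subst (fun n => if n is n'.+1 then Var n' else t) A.

Definition fshift (A : form) : form := subst (fun n => Var n.+1) A.

(* All free variables are < k. *)
Fixpoint tbounded (k : nat) (t : term) : bool :=
  match t with
  | Var n => n < k
  | Zero => true
  | Succ t => tbounded k t
  | Add t u | Mul t u => tbounded k t && tbounded k u
  end.

Fixpoint bounded (k : nat) (A : form) : bool :=
  match A with
  | Bot => true
  | Eq t u => tbounded k t && tbounded k u
  | Imp A B => bounded k A && bounded k B
  | All A => bounded k.+1 A
  end.

Definition sentence (A : form) : bool := bounded 0 A.

Definition Neg A := Imp A Bot.
Definition Top := Neg Bot.
Definition And A B := Neg (Imp A (Neg B)).
Definition Ex A := Neg (All (Neg A)).

Definition num (n : nat) : term := iter n Succ Zero.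

(* A Hilbert calculus for classical first-order logic with equality.
   Generalization is unrestricted because theories consist of sentences. *)
Inductive provable (T : form -> Prop) : form -> Prop :=
| PrAx A : T A -> provable T A
| PrK A B : provable T (Imp A (Imp B A))
| PrS A B C :
    provable T (Imp (Imp A (Imp B C)) (Imp (Imp A B) (Imp A C)))
| PrDN A : provable T (Imp (Neg (Neg A)) A)
| PrInst A t : provable T (Imp (All A) (inst A t))
| PrDist A B : provable T (Imp (All (Imp A B)) (Imp (All A) (All B)))
| PrVac A : provable T (Imp A (All (fshift A)))
| PrRefl t : provable T (Eq t t)
| PrLeibniz A t u :
    provable T (Imp (Eq t u) (Imp (inst A t) (inst A u)))
| PrMP A B : provable T (Imp A B) -> provable T A -> provable T B
| PrGen A : provable T A -> provable T (All A).

Definition theory (T : form -> Prop) : Prop := forall A, T A -> sentence A.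

Definition consistent (T : form -> Prop) : Prop := ~ provable T Bot.

Definition subtheory (T U : form -> Prop) : Prop := forall A, T A -> U A.

Inductive Q : form -> Prop :=
| Q1 : Q (All (Neg (Eq (Succ (Var 0)) Zero)))
| Q2 : Q (All (All (Imp (Eq (Succ (Var 1)) (Succ (Var 0)))
                        (Eq (Var 1) (Var 0)))))
| Q3 : Q (All (Imp (Neg (Eq (Var 0) Zero))
                   (Ex (Eq (Var 1) (Succ (Var 0))))))
| Q4 : Q (All (Eq (Add (Var 0) Zero) (Var 0)))
| Q5 : Q (All (All (Eq (Add (Var 1) (Succ (Var 0)))
                       (Succ (Add (Var 1) (Var 0))))))
| Q6 : Q (All (Eq (Mul (Var 0) Zero) Zero))
| Q7 : Q (All (All (Eq (Mul (Var 1) (Succ (Var 0)))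
                       (Add (Mul (Var 1) (Var 0)) (Var 1))))).

Definition cpair (a b : nat) : nat := 'C((a + b).+1, 2) + b.

Fixpoint tcode (t : term) : nat :=
  match t with
  | Var n => cpair 0 n
  | Zero => cpair 1 0
  | Succ t => cpair 2 (tcode t)
  | Add t u => cpair 3 (cpair (tcode t) (tcode u))
  | Mul t u => cpair 4 (cpair (tcode t) (tcode u))
  end.

Fixpoint fcode (A : form) : nat :=
  match A with
  | Bot => cpair 0 0
  | Eq t u => cpair 1 (cpair (tcode t) (tcode u))
  | Imp A B => cpair 2 (cpair (fcode A) (fcode B))
  | All A => cpair 3 (fcode A)
  end.

Definition re_theory (T : form -> Prop) : Prop :=
  re (fun n => exists A, T A /\ fcode A = n).

Definition fle t u := Ex (Eq (Add (Var 0) (shift 1 t)) (shift 1 u)).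
Definition flt t u := fle (Succ t) u.

(* The bound t lives outside the binder. *)
Definition ball_le t A := All (Imp (fle (Var 0) (shift 1 t)) A).
Definition ball_lt t A := All (Imp (flt (Var 0) (shift 1 t)) A).
Definition bex_le t A := Neg (ball_le t (Neg A)).

(* m nested bounded quantifiers, binding variables 0, ..., m - 1 of A. *)
Fixpoint bexn_le (m : nat) (t : term) (A : form) : form :=
  if m is m'.+1 then bex_le t (bexn_le m' (shift 1 t) A) else A.

(* Gödel's beta function: z is the remainder of a modulo 1 + (i + 1) d. *)
Definition beta (a d i z : term) : form :=
  let m := Succ (Mul (Succ i) d) in
  And (flt z m)
      (bex_le a (Eq (shift 1 a) (Add (Mul (Var 0) (shift 1 m)) (shift 1 z)))).

Definition tshift n (k : nat) (xs : n.-tuple term) : n.-tuple term :=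
  map_tuple (shift k) xs.

(* "f(xs) = y, by a computation whose intermediate values and whose codes of
   sequences of values are all <= b".  Every quantifier in [graph f b xs y] is
   bounded, so existentially quantifying b yields a Sigma_1 formula. *)
Fixpoint graph n (f : recf n) (b : term) : n.-tuple term -> term -> form :=
  match f in recf n return n.-tuple term -> term -> form with
  | RZero _ => fun _ y => Eq y Zero
  | RSucc => fun xs y => Eq y (Succ (thead xs))
  | RProj _ i => fun xs y => Eq y (tnth xs i)
  | RComp _ m f gs => fun xs y =>
      let b' := shift m b in
      bexn_le m b
        (And (\big[And/Top]_(i < m) graph (gs i) b' (tshift m xs) (Var i))
             (graph f b' [tuple Var i | i < m] (shift m y)))
  | RPrec _ f g => fun xs y =>
      let k := thead xs in
      let p := behead_tuple xs in
      bex_le b (bex_le (shift 1 b)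
        (And (bex_le (shift 2 b)
               (And (beta (Var 2) (Var 1) Zero (Var 0))
                    (graph f (shift 3 b) (tshift 3 p) (Var 0))))
        (And (ball_lt (shift 2 k)
               (bex_le (shift 3 b) (bex_le (shift 4 b)
                 (And (beta (Var 4) (Var 3) (Var 2) (Var 1))
                 (And (beta (Var 4) (Var 3) (Succ (Var 2)) (Var 0))
                      (graph g (shift 5 b)
                         (cons_tuple (Var 2) (cons_tuple (Var 1) (tshift 5 p)))
                         (Var 0)))))))
             (beta (Var 1) (Var 0) (shift 2 k) (shift 2 y)))))
  | RMin _ f => fun xs y =>
      And (graph f b (cons_tuple y xs) Zero)
          (ball_lt y
            (bex_le (shift 1 b)
              (graph f (shift 2 b) (cons_tuple (Var 1) (tshift 2 xs))
                 (Succ (Var 0)))))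
  end.

(* Formalizes "phi_n(n) is defined", with phi given by e. *)
Definition halts (e : recf 2) (n : nat) : form :=
  Ex (bex_le (Var 0) (graph e (Var 1) [tuple num n; num n] (Var 0))).

Definition diverges (e : recf 2) (n : nat) : form := Neg (halts e n).

(* Main.v *)
Require Import Defs.
From mathcomp Require Import all_boot zify.

Set Implicit Arguments.
Unset Strict Implicit.
Unset Printing Implicit Defensive.

(* The recursion theorem provides [u] with
   W_u = {n | T + "phi_u(u) converges" |- "phi_n(n) diverges"}; take
   U = T + "phi_u(u) converges".  If U were inconsistent, W_u would contain every
   number, so phi_u(u) would converge, and T would prove it by
   Sigma_1-completeness of Q; but then T itself would be inconsistent.
   The recursion theorem needs a partial recursive function enumerating the
   theorems of T.  The codes of theorems, together with auxiliary judgements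
   about substitution, form the least set closed under finitely many Horn clauses
   over pairing, and any such set is enumerated by course-of-values recursion on
   codes of derivations. *)

(** * Partial recursive functions and pairing *)

(** [eval] is only a relation and recursive enumerability speaks of domains of partial functions, so
    the step-bounded [stage] first turns such a domain into the range of a total function. From then
    on nearly everything is a total function of one packed number, and computability is proved
    compositionally. The halting formula needs its own induction on the definition of [e] in three
    respects: its true instances must be provable in Q, which concerns this particular [graph] and
    not some equivalent formula; its code must be computable from [n]; and it must be a sentence, so
    that the deduction theorem applies. The deduction theorem replaces provability in U by
    provability in T of an implication whose code is computable from [u] and [n]. This is what
    allows [u] to be fixed by the recursion theorem although U itself depends on [u]. *)

Lemma tuple1E (v : 1.-tuple nat) : v = [tuple thead v].
Proof. by apply: eq_from_tnth => i; rewrite !ord1. Qed.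

Lemma behead_cons n (x : nat) (v : n.-tuple nat) :
  behead_tuple (cons_tuple x v) = v.
Proof. exact: val_inj. Qed.

Lemma prec_graph_fun (base : nat -> Prop) (step : nat -> nat -> nat -> Prop) :
  (forall y y', base y -> base y' -> y = y') ->
  (forall k z y y', step k z y -> step k z y' -> y = y') ->
  forall k y y', prec_graph base step k y -> prec_graph base step k y' -> y = y'.
Proof.
move=> Hb Hs; elim=> [|k IH] y y' /=; first exact: Hb.
by move=> [z [/IH Hz Hy]] [z' [/Hz E Hy']]; subst z'; apply: Hs Hy Hy'.
Qed.

Lemma eval_fun n (f : recf n) v y y' : eval f v y -> eval f v y' -> y = y'.
Proof.
elim: f v y y' => {n} /=.
- by move=> n v y y' -> ->.
- by move=> v y y' -> ->.
- by move=> n i v y y' -> ->.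
- move=> n m f IHf gs IHg v y y' [w [Hw Hy]] [w' [Hw' Hy']].
  have E : w = w' by apply: eq_from_tnth => i; apply: (IHg i).
  by subst w'; apply: IHf Hy Hy'.
- move=> n f IHf g IHg v y y'; apply: prec_graph_fun => [u u'|k z u u'].
    exact: IHf.
  exact: IHg.
- move=> n f IHf v y y' [Hy Hlt] [Hy' Hlt'].
  case: (ltngtP y y') => // [/Hlt' [k Hk]|/Hlt [k Hk]].
    by have := IHf _ _ _ Hy Hk.
  by have := IHf _ _ _ Hy' Hk.
Qed.

Definition computable n (F : n.-tuple nat -> nat) : Prop :=
  exists f : recf n, forall v y, eval f v y <-> y = F v.

Lemma computable_ext n (F G : n.-tuple nat -> nat) :
  F =1 G -> computable F -> computable G.
Proof. by move=> E [f Hf]; exists f => v y; rewrite Hf E. Qed.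

Lemma computable_proj n (i : 'I_n) : computable (fun v => tnth v i).
Proof. by exists (RProj i). Qed.

Lemma computable_comp n m (F : m.-tuple nat -> nat)
    (G : 'I_m -> n.-tuple nat -> nat) :
  computable F -> (forall i, computable (G i)) ->
  computable (fun v => F [tuple G i v | i < m]).
Proof.
move=> [f Hf] /fin_all_exists [gs Hg]; exists (RComp f gs) => v y /=.
split=> [[w [Hw /Hf ->]]|->].
  by congr F; apply: eq_from_tnth => i; rewrite tnth_mktuple; apply/Hg.
exists [tuple G i v | i < m]; split; last exact/Hf.
by move=> i; rewrite tnth_mktuple; apply/Hg.
Qed.

Lemma computable_zero n : computable (fun _ : n.-tuple nat => 0).
Proof. by exists (RZero n). Qed.

Lemma computable_succ n (F : n.-tuple nat -> nat) :
  computable F -> computable (fun v => (F v).+1).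
Proof.
move=> HF; have HS : computable (fun v : 1.-tuple nat => (thead v).+1).
  by exists RSucc.
have := @computable_comp n 1 _ (fun=> F) HS (fun=> HF).
by apply: computable_ext => v /=; rewrite /thead tnth_mktuple.
Qed.

Lemma computable_const n c : computable (fun _ : n.-tuple nat => c).
Proof.
elim: c => [|c IH]; [exact: computable_zero|exact: computable_succ].
Qed.

Lemma computable_prec n (F : n.-tuple nat -> nat) (G : n.+2.-tuple nat -> nat)
    (K : n.-tuple nat -> nat) :
  computable F -> computable G -> computable K ->
  computable (fun v =>
    iteri (K v) (fun k z => G (cons_tuple k (cons_tuple z v))) (F v)).
Proof.
move=> [f Hf] [g Hg] HK.
have HP : computable (fun v : n.+1.-tuple nat =>
    iteri (thead v)
      (fun k z => G (cons_tuple k (cons_tuple z (behead_tuple v))))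
      (F (behead_tuple v))).
  exists (RPrec f g) => v y /=; move: (thead v) (behead_tuple v) => k p.
  elim: k y => [|k IH] y /=; first exact: Hf.
  split=> [[z [/IH -> /Hg ->]] //|->].
  by eexists; split; [apply/IH|apply/Hg].
(* [RPrec] recurses on its first argument; prepending [K v] to [v] makes the number of rounds any
   computable function. *)
pose L (i : 'I_n.+1) v := if unlift ord0 i is Some j then tnth v j else K v.
have HL i : computable (L i).
  by rewrite /L; case: (unlift _ i) => [j|] //; exact: computable_proj.
have := computable_comp HP HL; apply: computable_ext => v.
have -> : [tuple L i v | i < n.+1] = cons_tuple (K v) v.
  apply: eq_from_tnth => i; rewrite tnth_mktuple /L.
  by case: unliftP => [j ->|->]; rewrite ?tnthS.
by rewrite behead_cons.
Qed.

Lemma computable_pred n (F : n.-tuple nat -> nat) :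
  computable F -> computable (fun v => (F v).-1).
Proof.
move=> HF.
have := computable_prec (computable_zero n) (computable_proj (ord0 : 'I_n.+2)) HF.
by apply: computable_ext => v; case: (F v).
Qed.

Lemma computable_add n (F G : n.-tuple nat -> nat) :
  computable F -> computable G -> computable (fun v => F v + G v).
Proof.
move=> HF HG.
have := computable_prec HF
  (computable_succ (computable_proj (lift ord0 ord0 : 'I_n.+2))) HG.
apply: computable_ext => v; elim: (G v) => [|k /= ->]; first by rewrite addn0.
by rewrite tnthS addnS.
Qed.

Lemma computable_sub n (F G : n.-tuple nat -> nat) :
  computable F -> computable G -> computable (fun v => F v - G v).
Proof.
move=> HF HG.
have := computable_prec HF
  (computable_pred (computable_proj (lift ord0 ord0 : 'I_n.+2))) HG.
apply: computable_ext => v; elim: (G v) => [|k /= ->]; first by rewrite subn0.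
by rewrite tnthS subnS.
Qed.

Lemma computable_tri n (F : n.-tuple nat -> nat) :
  computable F -> computable (fun v => 'C((F v).+1, 2)).
Proof.
move=> HF.
have := computable_prec (computable_zero n)
  (computable_add (computable_proj (lift ord0 ord0 : 'I_n.+2))
     (computable_succ (computable_proj (ord0 : 'I_n.+2)))) HF.
apply: computable_ext => v; elim: (F v) => [|k /= ->]; first by [].
by rewrite tnthS [tnth _ ord0]/= [in RHS]binS bin1 addnC.
Qed.

Lemma computable_cpair n (F G : n.-tuple nat -> nat) :
  computable F -> computable G -> computable (fun v => cpair (F v) (G v)).
Proof.
by move=> HF HG; apply: computable_add => //; apply/computable_tri/computable_add.
Qed.

(* The diagonal of the pair coded by [n]. *)
Definition cdiag (n : nat) : nat :=
  iteri n (fun k z => z + (1 - ('C(z.+2, 2) - k.+1))) 0.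

Definition csnd n := n - 'C((cdiag n).+1, 2).
Definition cfst n := cdiag n - csnd n.

(** The truncated difference [1 - ('C(z.+2, 2) - n.+1)] is the indicator that [n.+1] has reached the
    next triangular number, so the recursion moves to the next diagonal exactly then. *)
Lemma cdiagP n : 'C((cdiag n).+1, 2) <= n < 'C((cdiag n).+2, 2).
Proof.
elim: n => [|n]; first by [].
rewrite [cdiag n.+1]/= -/(cdiag n); move: (cdiag n) => z.
have := binS z.+2 1; have := binS z.+1 1; rewrite !bin1 => E1 E2 IH.
case: (leqP 'C(z.+2, 2) n.+1) => H.
  have -> : z + (1 - ('C(z.+2, 2) - n.+1)) = z.+1 by lia.
  lia.
have -> : z + (1 - ('C(z.+2, 2) - n.+1)) = z by lia.
lia.
Qed.

Lemma cdiag_cpair a b : cdiag (cpair a b) = a + b.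
Proof.
have /andP[H1 H2] := cdiagP (cpair a b); move: H1 H2.
rewrite {2 3}/cpair; move: (cdiag _) => z H1 H2.
have := binS (a + b).+1 1; rewrite bin1 => E.
have mono x y : x <= y -> 'C(x, 2) <= 'C(y, 2) by apply: leq_bin2l.
case: (ltngtP z (a + b)) => // H.
  have := mono z.+2 (a + b).+1; lia.
have := mono (a + b).+2 z.+1; lia.
Qed.

Lemma csnd_cpair a b : csnd (cpair a b) = b.
Proof. by rewrite /csnd cdiag_cpair /cpair addKn. Qed.

Lemma cfst_cpair a b : cfst (cpair a b) = a.
Proof. by rewrite /cfst csnd_cpair cdiag_cpair addnK. Qed.

Lemma cpair_inj a b c d : cpair a b = cpair c d -> a = c /\ b = d.
Proof.
move=> E; split.
  by rewrite -(cfst_cpair a b) E cfst_cpair.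
by rewrite -(csnd_cpair a b) E csnd_cpair.
Qed.

Lemma leq_cpairl a b : a <= cpair a b.
Proof. by rewrite /cpair binS bin1; lia. Qed.

Lemma leq_cpairr a b : b <= cpair a b.
Proof. by rewrite /cpair leq_addl. Qed.

Lemma computable_cdiag n (F : n.-tuple nat -> nat) :
  computable F -> computable (fun v => cdiag (F v)).
Proof.
move=> HF; pose z := computable_proj (lift ord0 ord0 : 'I_n.+2).
have := computable_prec (computable_zero n)
  (computable_add z (computable_sub (computable_const _ 1)
     (computable_sub (computable_tri (computable_succ z))
       (computable_succ (computable_proj (ord0 : 'I_n.+2)))))) HF.
apply: computable_ext => v; rewrite /cdiag; elim: (F v) => [|k /= ->]; first by [].
by rewrite tnthS [tnth _ ord0]/= [tnth _ ord0]/=.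
Qed.

Lemma computable_csnd n (F : n.-tuple nat -> nat) :
  computable F -> computable (fun v => csnd (F v)).
Proof.
by move=> HF; apply: computable_sub => //; apply/computable_tri/computable_cdiag.
Qed.

Lemma computable_cfst n (F : n.-tuple nat -> nat) :
  computable F -> computable (fun v => cfst (F v)).
Proof.
move=> HF; apply: computable_sub; first exact: computable_cdiag.
exact: computable_csnd.
Qed.

(** Several arguments are packed into one by [cpair], which avoids tuple bookkeeping in the closure
    lemmas below. *)
Definition computable1 (F : nat -> nat) : Prop :=
  computable (fun v : 1.-tuple nat => F (thead v)).

Lemma computable1_ext (F G : nat -> nat) :
  F =1 G -> computable1 F -> computable1 G.
Proof. by move=> E; apply: computable_ext => v. Qed.

Lemma computable1_id : computable1 id.
Proof. exact: computable_proj. Qed.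

Lemma computable1_comp n (F : nat -> nat) (G : n.-tuple nat -> nat) :
  computable1 F -> computable G -> computable (fun v => F (G v)).
Proof.
move=> HF HG; have := @computable_comp n 1 _ (fun=> G) HF (fun=> HG).
by apply: computable_ext => v /=; rewrite /thead tnth_mktuple.
Qed.

Lemma computable1_rec (F : nat -> nat) (G : nat -> nat -> nat -> nat)
    (K : nat -> nat) :
  computable1 F ->
  computable1 (fun w => G (cfst w) (cfst (csnd w)) (csnd (csnd w))) ->
  computable1 K ->
  computable1 (fun x => iteri (K x) (fun k z => G k z x) (F x)).
Proof.
move=> HF HG HK; pose pr i := computable_proj (i : 'I_3).
have := computable_prec HF (computable1_comp HG (computable_cpair (pr ord0)
  (computable_cpair (pr (lift ord0 ord0)) (pr (lift ord0 (lift ord0 ord0))))))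
  HK.
apply: computable_ext => v; elim: (K _) => [|k /= ->] //.
by rewrite !tnthS !(csnd_cpair, cfst_cpair).
Qed.

(** A case distinction is a recursion of length [F x] that ignores its accumulator: the last round
    has index [k] when [F x = k.+1]. *)
Lemma computable1_case (F G : nat -> nat) (H : nat -> nat -> nat) :
  computable1 F -> computable1 G ->
  computable1 (fun w => H (cfst w) (csnd w)) ->
  computable1 (fun x => if F x is k.+1 then H k x else G x).
Proof.
move=> HF HG HH.
have := @computable1_rec G (fun k _ x => H k x) F HG _ HF.
have HG' : computable1 (fun w => H (cfst w) (csnd (csnd w))).
  have := @computable1_comp 1 _
    (fun w => cpair (cfst (thead w)) (csnd (csnd (thead w)))) HH.
  rewrite /computable1 => A.
  have := A (computable_cpair (computable_cfst computable1_id)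
    (computable_csnd (computable_csnd computable1_id))).
  by apply: computable_ext => v; rewrite cfst_cpair csnd_cpair.
by move=> /(_ HG'); apply: computable1_ext => x; case: (F x).
Qed.

Lemma computable1_if_eq (A B F G : nat -> nat) :
  computable1 A -> computable1 B -> computable1 F -> computable1 G ->
  computable1 (fun x => if A x == B x then F x else G x).
Proof.
move=> HA HB HF HG.
have HG' : computable1 (fun w => G (csnd w)).
  exact: computable1_comp HG (computable_csnd computable1_id).
(* The two truncated differences vanish together exactly when the values agree. *)
have HE : computable1 (fun x => (A x - B x) + (B x - A x)).
  by apply: computable_add; exact: computable_sub.
have := @computable1_case _ _ (fun _ x => G x) HE HF HG'.
apply: computable1_ext => x; case: eqP => [->|E]; first by rewrite subnn.
by case D: (_ + _) => //; lia.
Qed.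

(** * Step-bounded evaluation *)

(* [stage s f v] is [y.+1] when [f] takes the value [y] at [v] and every
   unbounded search involved stops before [s], and [0] otherwise.  In the search
   of [RMin], the state is 0 while searching, 1 when blocked, and [z.+2] when
   [z] was found. *)
Fixpoint stage (s n : nat) (f : recf n) : n.-tuple nat -> nat :=
  match f in recf n return n.-tuple nat -> nat with
  | RZero _ => fun _ => 1
  | RSucc => fun v => (thead v).+2
  | RProj _ i => fun v => (tnth v i).+1
  | RComp _ m f gs => fun v =>
      if \sum_(i < m) (1 - stage s (gs i) v) is _.+1 then 0
      else stage s f [tuple (stage s (gs i) v).-1 | i < m]
  | RPrec _ f g => fun v =>
      iteri (thead v) (fun k z => if z is z'.+1 then
            stage s g (cons_tuple k (cons_tuple z' (behead_tuple v))) else 0)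
        (stage s f (behead_tuple v))
  | RMin _ f => fun v =>
      (iteri s (fun z r => if r is r'.+1 then r'.+1 else
           if stage s f (cons_tuple z v) is a.+1
           then if a is _.+1 then 0 else z.+2 else 1) 0).-1
  end.

Lemma stage_sound s n (f : recf n) v y : stage s f v = y.+1 -> eval f v y.
Proof.
elim: f v y => {n} /=.
- by move=> n v y [<-].
- by move=> v y [<-].
- by move=> n i v y [<-].
(* The sum counts the arguments without a value; when it is 0, all the predecessors are genuine
   values. *)
- move=> n m f IHf gs IHg v y; case E: (\sum_(i < m) _) => [|//] H.
  exists [tuple (stage s (gs i) v).-1 | i < m]; split; last exact: IHf.
  move=> i; apply: IHg; rewrite tnth_mktuple.
  move/eqP: E; rewrite sum_nat_eq0 => /forallP /(_ i) /=.
  by case: (stage _ _ _).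
- move=> n f IHf g IHg v y; move: (thead v) => k.
  elim: k y => [|k IH] y /=; first exact: IHf.
  set r := (X in if X is _.+1 then _ else _).
  case E: r => [//|z] H.
  by exists z; split; [exact: IH|exact: IHg].
- move=> n f IHf v y; set F : nat -> nat -> nat := fun z r => _.
  (* Loop invariant of the search, one clause per state; a blocked search claims nothing. *)
  have inv m : match iteri m F 0 with
      | 0 => forall z, z < m -> exists k, eval f (cons_tuple z v) k.+1
      | 1 => True
      | y.+2 => eval f (cons_tuple y v) 0 /\
          (forall z, z < y -> exists k, eval f (cons_tuple z v) k.+1)
      end.
    elim: m => [|m] //=; case: (iteri m _ _) => [|r] IH //=.
    case E: (stage s f (cons_tuple m v)) => [|[|a]] //.
      by split; first exact: IHf.
    move=> z; rewrite ltnS leq_eqVlt => /orP[/eqP ->|]; last exact: IH.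
    by exists a; apply: IHf.
  by move: (inv s); case: (iteri s _ _) => [|[|r]] //= H [<-].
Qed.

(** Finitely many thresholds have a maximum. This serves both for stages of evaluation and for the
    bounds in the halting formula. *)
Lemma eventually_all (P : nat -> nat -> Prop) m :
  (forall i, i < m -> exists b, forall B, b <= B -> P i B) ->
  exists b, forall B, b <= B -> forall i, i < m -> P i B.
Proof.
elim: m => [|m IH] H; first by exists 0.
have [|b Hb] := IH; first by move=> i Hi; apply: H; lia.
have [c Hc] := H m (leqnn _); exists (maxn b c) => B HB i.
rewrite ltnS leq_eqVlt => /orP[/eqP ->|Hi]; first by apply: Hc; lia.
by apply: Hb => //; lia.
Qed.

Lemma eventually_ord m (P : 'I_m -> nat -> Prop) :
  (forall i, exists b, forall B, b <= B -> P i B) ->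
  exists b, forall B, b <= B -> forall i, P i B.
Proof.
move=> H.
have [|b Hb] := @eventually_all
  (fun i B => forall Hi : i < m, P (Ordinal Hi) B) m.
  move=> i Hi; have [b Hb] := H (Ordinal Hi); exists b => B /Hb HB Hi'.
  by rewrite (bool_irrelevance Hi' Hi).
by exists b => B /Hb HB [i Hi]; apply: HB.
Qed.

(** The nested existentials become one sequence, so that a single threshold can be chosen for all
    rounds and the values can be coded by the beta function. *)
Lemma prec_graph_seq (base : nat -> Prop) (step : nat -> nat -> nat -> Prop) k y :
  prec_graph base step k y -> exists c : nat -> nat,
    [/\ base (c 0), c k = y & forall i, i < k -> step i (c i) (c i.+1)].
Proof.
elim: k y => [|k IH] y /=; first by move=> H; exists (fun=> y).
move=> [z [/IH [c [H0 Hk Hs]] Hy]].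
exists (fun i => if i <= k then c i else y); split=> //=; first by rewrite ltnn.
move=> i; rewrite [i < k.+1]ltnS leq_eqVlt => /orP[/eqP ->|Hi].
  by rewrite ltnn eqxx Hk.
by rewrite Hi orbT; apply: Hs.
Qed.

Lemma stage_complete n (f : recf n) v y :
  eval f v y -> exists s0, forall s, s0 <= s -> stage s f v = y.+1.
Proof.
elim: f v y => {n} /=.
- by move=> n v y ->; exists 0.
- by move=> v y ->; exists 0.
- by move=> n i v y ->; exists 0.
- move=> n m f IHf gs IHg v y [w [Hw /IHf [a Ha]]].
  have [b Hb] := eventually_ord (fun i => IHg i _ _ (Hw i)).
  exists (maxn a b) => s Hs.
  have E i : stage s (gs i) v = (tnth w i).+1 by apply: Hb; lia.
  rewrite big1 => [|i _]; last by rewrite E.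
  rewrite -(Ha s) ?geq_max; last by lia.
  by congr stage; apply: eq_from_tnth => i; rewrite tnth_mktuple E.
- move=> n f IHf g IHg v y /prec_graph_seq [c [/IHf [a Ha] <- Hs]].
  have [b Hb] := eventually_all (fun i Hi => IHg _ _ (Hs i Hi)).
  exists (maxn a b) => s Hab; move: (thead v) Hb => k Hb.
  have {}Hb i : i < k -> _ := Hb s _ i; move: Hb; elim: k {Hs} => [|k IH] Hb /=.
    by apply: Ha; lia.
  by rewrite IH => [|i Hi Hi']; rewrite Hb //; lia.
- move=> n f IHf v y [/IHf [a Ha] Hlt].
  have [|b Hb] := @eventually_all
    (fun z B => exists k, stage B f (cons_tuple z v) = k.+2) y.
    by move=> z /Hlt [k /IHf [b Hb]]; exists b => B /Hb ->; exists k.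
  (* The search needs [y.+1] rounds to test [y]. [L] says that it is still running before that test,
     [R] that the result is kept afterwards. *)
  exists (maxn y.+1 (maxn a b)) => s Hs; set F : nat -> nat -> nat := fun z r => _.
  have L z : z <= y -> iteri z F 0 = 0.
    elim: z => [|z IH] Hz //=; rewrite IH; last exact: ltnW.
    by rewrite /F; have [k ->] := Hb s (ltac:(lia)) z Hz.
  have R d : iteri (d + y.+1) F 0 = y.+2.
    elim: d => [|d IH]; last by rewrite addSn /= IH.
    by rewrite /= L // /F Ha //; lia.
  by rewrite -(@subnK y.+1 s) ?R //; lia.
Qed.

Lemma computable1_sum m (F : 'I_m -> nat -> nat) :
  (forall i, computable1 (F i)) -> computable1 (fun x => \sum_(i < m) F i x).
Proof.
elim: m F => [|m IH] F H.
  by apply: computable1_ext (computable_const 1 0) => x; rewrite big_ord0.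
have := computable_add (H ord0) (IH (fun i => F (lift ord0 i)) (fun i => H _)).
by apply: computable_ext => v; rewrite big_ord_recl.
Qed.

(** The recursion on [f] happens outside the computation: each fixed [f] gives one composition. [S]
    and [V] are functions of [x] because in the inner calls the step bound and the arguments are
    read off a packed recursion state. *)
Lemma computable1_stage n (f : recf n) (S : nat -> nat) (V : 'I_n -> nat -> nat) :
  computable1 S -> (forall i, computable1 (V i)) ->
  computable1 (fun x => stage (S x) f [tuple V i x | i < n]).
Proof.
have H1 : computable1 cfst := computable_cfst computable1_id.
have H2 : computable1 csnd := computable_csnd computable1_id.
have comp F G : computable1 F -> computable1 G -> computable1 (fun x => F (G x)).
  exact: computable1_comp.
elim: f S V => {n}.
- by move=> n S V HS HV; exact: computable_const.
- move=> S V HS HV; apply: computable_succ; apply: computable_succ.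
  by apply: computable_ext (HV ord0) => x; rewrite /thead tnth_mktuple.
- move=> n i S V HS HV; apply: computable_succ.
  by apply: computable_ext (HV i) => x; rewrite tnth_mktuple.
- move=> n m f IHf gs IHg S V HS HV /=.
  apply: (@computable1_case (fun x => \sum_(i < m)
     (1 - stage (S x) (gs i) [tuple V i x | i < n])) _ (fun _ _ => 0)).
  + apply: computable1_sum => i; apply: computable_sub.
      exact: computable_const.
    exact: IHg.
  + have := IHf S (fun i x => (stage (S x) (gs i) [tuple V i x | i < n]).-1) HS.
    by apply=> i; apply/computable_pred/IHg.
  + exact: computable_const.
- move=> n f IHf g IHg S V HS HV /=.
  have E x : behead_tuple [tuple V i x | i < n.+1] =
      [tuple V (lift ord0 i) x | i < n].
    apply: eq_from_tnth => i; rewrite tnth_behead !tnth_mktuple.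
    have -> // : inord i.+1 = lift ord0 i.
    by apply: val_inj; rewrite /= inordK ?ltnS.
  have := @computable1_rec
    (fun x => stage (S x) f [tuple V (lift ord0 i) x | i < n])
    (fun k z x => if z is z'.+1 then stage (S x) g
       (cons_tuple k (cons_tuple z' [tuple V (lift ord0 i) x | i < n])) else 0)
    (V ord0) (IHf _ _ HS (fun i => HV _)) _ (HV ord0).
  move=> A; apply: computable1_ext (A _) => [x|].
    by rewrite E /thead tnth_mktuple.
  apply: (@computable1_case (fun w => cfst (csnd w)) (fun=> 0)
    (fun z' w => stage (S (csnd (csnd w))) g
       (cons_tuple (cfst w) (cons_tuple z'
          [tuple V (lift ord0 i) (csnd (csnd w)) | i < n])))).
  + exact: comp.
  + exact: computable_const.
  (* Here [w] packs [z'], then the round [k], the previous state, and the original input. *)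
  + pose V' (i : 'I_n.+2) w := match unlift ord0 i with
      | None => cfst (csnd w)
      | Some j => match unlift ord0 j with
        | None => cfst w
        | Some l => V (lift ord0 l) (csnd (csnd (csnd w)))
        end
      end.
    have HV' i : computable1 (V' i).
      rewrite /V'; case: (unlift _ i) => [j|]; last exact: comp.
      case: (unlift _ j) => [l|] //.
      exact: comp (HV _) (comp _ _ H2 (comp _ _ H2 H2)).
    have := IHg _ _ (comp _ _ HS (comp _ _ H2 (comp _ _ H2 H2))) HV'.
    apply: computable1_ext => w; congr stage.
    apply: eq_from_tnth => i; rewrite tnth_mktuple /V'.
    case: unliftP => [j ->|->]; last by [].
    rewrite tnthS; case: unliftP => [l ->|->]; last by [].
    by rewrite tnthS tnth_mktuple.
- move=> n f IHf S V HS HV /=; apply: computable_pred.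
  apply: (@computable1_rec (fun=> 0) (fun z r x => if r is r'.+1 then r'.+1 else
     if stage (S x) f (cons_tuple z [tuple V i x | i < n]) is a.+1
     then if a is _.+1 then 0 else z.+2 else 1)) => //.
    exact: computable_const.
  apply: (@computable1_case (fun w => cfst (csnd w)) _ (fun k w => k.+1)).
  + exact: comp.
  + apply: (@computable1_case (fun w => stage (S (csnd (csnd w))) f
      (cons_tuple (cfst w) [tuple V i (csnd (csnd w)) | i < n])) (fun=> 1)
      (fun a w => if a is _.+1 then 0 else (cfst w).+2)).
    * pose V' (i : 'I_n.+1) w := if unlift ord0 i is Some j
        then V j (csnd (csnd w)) else cfst w.
      have HV' i : computable1 (V' i).
        rewrite /V'; case: (unlift _ i) => [j|] //.
        exact: comp (HV _) (comp _ _ H2 H2).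
      have := IHf _ _ (comp _ _ HS (comp _ _ H2 H2)) HV'.
      apply: computable1_ext => w; congr stage.
      apply: eq_from_tnth => i; rewrite tnth_mktuple /V'.
      by case: unliftP => [j ->|->]; rewrite ?tnthS ?tnth_mktuple.
    * exact: computable_const.
    * apply: (@computable1_case cfst (fun w => (cfst (csnd w)).+2) (fun _ _ => 0)).
      - exact: H1.
      - by apply: computable_succ; apply: computable_succ; exact: comp.
      - exact: computable_const.
  + by apply: computable_succ; exact: H1.
Qed.

(* The value 0 of the enumeration means "no output yet". *)
Lemma re_enum (A : nat -> Prop) : re A -> exists h : nat -> nat,
  computable1 h /\ forall n, A n <-> exists w, h w = n.+1.
Proof.
move=> [f Hf].
(* Dovetailing: [x] pairs a step bound with an input. *)
pose g x := stage (cfst x) f [tuple csnd x].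
exists (fun x => if g x is _.+1 then (csnd x).+1 else 0); split.
  apply: (@computable1_case g (fun=> 0) (fun _ x => (csnd x).+1)).
  - have := @computable1_stage 1 f cfst (fun=> csnd) (computable_cfst computable1_id)
      (fun=> computable_csnd computable1_id).
    apply: computable1_ext => x; congr stage.
    by apply: eq_from_tnth => i; rewrite tnth_mktuple ord1.
  - exact: computable_const.
  - apply: computable_succ.
    by do 2 apply: computable_csnd; exact: computable1_id.
move=> n; rewrite Hf; split=> [[y /stage_complete [s /(_ s (leqnn _)) H]]|[w]].
  by exists (cpair s n); rewrite /g cfst_cpair csnd_cpair H.
by rewrite /g; case E: (stage _ _ _) => [//|y] [<-]; exists y; apply: stage_sound E.
Qed.

(** * Inductively generated sets of numbers *)

(** The number [r] codes an instance of a rule with conclusion [c r] and premises [p1 r], [p2 r].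
    Rules with fewer premises are padded with 0. *)
Inductive generated (c p1 p2 : nat -> nat) : nat -> Prop :=
| gen_base : generated c p1 p2 0
| gen_step r : generated c p1 p2 (p1 r) -> generated c p1 p2 (p2 r) ->
    generated c p1 p2 (c r).

(** Lists of values keep the latest one in front, so entry [i] of [n] lies at depth [n - i.+1]. *)
Definition history_get (l n i : nat) : nat := cfst (iter (n - i.+1) csnd l).

(* Value number [n] of the enumeration, from the list [l] of the previous ones;
   [n.+1] codes a rule and two earlier positions. *)
Definition gen_next (c p1 p2 : nat -> nat) (n l : nat) : nat :=
  if n is s.+1 then
    if history_get l n (cfst (csnd s)) == p1 (cfst s) then
      if history_get l n (csnd (csnd s)) == p2 (cfst s) then c (cfst s) else 0
    else 0
  else 0.

Definition gen_history (c p1 p2 : nat -> nat) (n : nat) : nat :=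
  iteri n (fun k l => cpair (gen_next c p1 p2 k l) l) 0.

Definition gen_enum c p1 p2 n := gen_next c p1 p2 n (gen_history c p1 p2 n).

Lemma gen_historyP c p1 p2 n i :
  i < n -> history_get (gen_history c p1 p2 n) n i = gen_enum c p1 p2 i.
Proof.
rewrite /history_get; elim: n => // n IH Hi; rewrite subSS.
have [->|E] : i = n \/ i < n by lia.
  by rewrite subnn /= cfst_cpair.
rewrite -(IH E); have -> : n - i = (n - i.+1).+1 by lia.
by rewrite iterSr /= csnd_cpair.
Qed.

(** A failed check outputs 0, which is generated anyway, so no error value is needed. Conversely, a
    pair bounds its components, so the position coding a rule instance and two positions comes after
    both. *)
Lemma gen_enumP c p1 p2 x :
  generated c p1 p2 x <-> exists n, gen_enum c p1 p2 n = x.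
Proof.
split=> [|[n <-]].
  elim=> [|r _ [n1 H1] _ [n2 H2]]; first by exists 0.
  exists (cpair r (cpair n1 n2)).+1.
  have L1 := leq_cpairl n1 n2; have L2 := leq_cpairr n1 n2.
  have L3 := leq_cpairr r (cpair n1 n2).
  rewrite /gen_enum /gen_next !(cfst_cpair, csnd_cpair).
  by rewrite !gen_historyP ?H1 ?H2 ?eqxx //; lia.
elim/ltn_ind: n => [[|s]] IH; first exact: gen_base.
rewrite /gen_enum /gen_next.
have L s' : cfst s' <= s' /\ csnd s' <= s'.
  by rewrite /cfst /csnd; have := cdiagP s'; rewrite binS bin1; lia.
have [_ L1] := L s; have [L2 L3] := L (csnd s).
rewrite !gen_historyP; try lia.
case: eqP => [E1|_]; last exact: gen_base.
case: eqP => [E2|_]; last exact: gen_base.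
by apply: gen_step; [rewrite -E1|rewrite -E2]; apply: IH; lia.
Qed.

Lemma computable1_gen_enum c p1 p2 :
  computable1 c -> computable1 p1 -> computable1 p2 ->
  computable1 (gen_enum c p1 p2).
Proof.
move=> Hc H1 H2.
have F : computable1 cfst := computable_cfst computable1_id.
have S : computable1 csnd := computable_csnd computable1_id.
have C A B : computable1 A -> computable1 B -> computable1 (fun x => A (B x)).
  exact: computable1_comp.
have get L N I : computable1 L -> computable1 N -> computable1 I ->
    computable1 (fun x => history_get (L x) (N x) (I x)).
  move=> HL HN HI; apply: computable_cfst.
  have HK : computable1 (fun x => N x - (I x).+1).
    by apply: computable_sub => //; exact: computable_succ.
  have HG : computable1 (fun w => csnd (cfst (csnd w))).
    exact: (C _ _ S (C _ _ F S)).
  have := @computable1_rec L (fun _ z _ => csnd z) _ HL HG HK.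
  apply: computable_ext.
  by move=> x; elim: (_ - _) => //= k ->.
have next N L : computable1 N -> computable1 L ->
    computable1 (fun x => gen_next c p1 p2 (N x) (L x)).
  move=> HN HL; apply: (@computable1_case N (fun=> 0) (fun s x =>
    if history_get (L x) (N x) (cfst (csnd s)) == p1 (cfst s) then
      if history_get (L x) (N x) (csnd (csnd s)) == p2 (cfst s) then c (cfst s)
      else 0 else 0)) => //; first exact: computable_const.
  have SF : computable1 (fun w => csnd (cfst w)) by exact: C.
  have FF : computable1 (fun w => cfst (cfst w)) by exact: C.
  apply: computable1_if_eq; last exact: computable_const.
  - by apply: get; exact: C.
  - exact: C.
  apply: computable1_if_eq; last exact: computable_const.
  - by apply: get; exact: C.
  - exact: C.
  - exact: C.
apply: (next); first exact: computable1_id.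
apply: (@computable1_rec (fun=> 0) (fun k l _ => cpair (gen_next c p1 p2 k l) l)).
- exact: computable_const.
- exact: (computable_cpair (next cfst _ F (C _ _ F S)) (C _ _ F S)).
- exact: computable1_id.
Qed.

(* [PApp] applies the enumeration of the axioms, the only part of a program that
   is not a pattern over pairing. *)
Inductive pat : Type :=
| PVar of nat
| PConst of nat
| PSucc of pat
| PPair of pat & pat
| PApp of pat.

Section Horn.

Variable h : nat -> nat.

Fixpoint peval (env : nat -> nat) (p : pat) : nat :=
  match p with
  | PVar i => env i
  | PConst c => c
  | PSucc p => (peval env p).+1
  | PPair p q => cpair (peval env p) (peval env q)
  | PApp p => h (peval env p)
  end.

(* A conclusion and two premises; the premise [0] is always derivable. *)
Definition rule : Type := pat * pat * pat.

Definition triv_rule : rule := (PConst 0, PConst 0, PConst 0).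

Definition cenv (e i : nat) : nat := cfst (iter i csnd e).

(** Reading past the end agrees with the default of [nth] because 0 unpairs to 0 and 0. *)
Lemma cenv_seq (s : seq nat) : cenv (foldr cpair 0 s) =1 nth 0 s.
Proof.
move=> i; elim: s i => [|x s IH] i.
  by rewrite nth_nil /cenv; have -> : iter i csnd 0 = 0 by elim: i => //= i ->.
case: i => [|i]; first by rewrite /cenv /= cfst_cpair.
by rewrite [RHS]/= -IH /cenv iterSr /= csnd_cpair.
Qed.

Lemma eq_peval env env' p : env =1 env' -> peval env p = peval env' p.
Proof. by move=> E; elim: p => //= [p ->|p -> q ->|p ->]. Qed.

(* Number [r] codes a rule index and an environment. *)
Definition rule_eval (P : seq rule) (pr : rule -> pat) (r : nat) : nat :=
  peval (cenv (csnd r)) (pr (nth triv_rule P (cfst r))).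

Definition derivable (P : seq rule) : nat -> Prop :=
  generated (rule_eval P (fun r => r.1.1)) (rule_eval P (fun r => r.1.2))
    (rule_eval P (fun r => r.2)).

Lemma der_rule (P : seq rule) (i : nat) (env : seq nat)
    (r := nth triv_rule P i) :
  derivable P (peval (nth 0 env) r.1.2) ->
  derivable P (peval (nth 0 env) r.2) ->
  derivable P (peval (nth 0 env) r.1.1).
Proof.
have E pr : rule_eval P pr (cpair i (foldr cpair 0 env)) =
    peval (nth 0 env) (pr r).
  by rewrite /rule_eval cfst_cpair csnd_cpair; apply/eq_peval/cenv_seq.
rewrite -(E (fun r => r.1.2)) -(E (fun r => r.2)) -(E (fun r => r.1.1)).
exact: gen_step.
Qed.

Lemma derivable_sound (P : seq rule) (V : nat -> Prop) : V 0 ->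
  (forall i env (r := nth triv_rule P i),
    V (peval env r.1.2) -> V (peval env r.2) -> V (peval env r.1.1)) ->
  forall x, derivable P x -> V x.
Proof. by move=> V0 VS x; elim=> // r _ H1 _ H2; apply: VS. Qed.

Hypothesis Hh : computable1 h.

Lemma computable1_peval p : computable1 (fun c => peval (cenv (csnd c)) p).
Proof.
elim: p => /= [i|c|p IH|p IHp q IHq|p IH].
- have S : computable1 (fun c => iter i csnd (csnd c)).
    by elim: i => [|i IH] /=; apply: computable_csnd => //; exact: computable1_id.
  exact: computable_cfst.
- exact: computable_const.
- exact: (computable_succ IH).
- exact: (computable_cpair IHp IHq).
- exact: (computable1_comp Hh IH).
Qed.

Lemma derivable_enum P : exists E, computable1 E /\
  forall x, derivable P x <-> exists n, E n = x.
Proof.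
have K pr : computable1 (rule_eval P pr).
  (* The offset [i] makes the lookup in a fixed list a chain of case distinctions on [cfst c - i],
     which the induction on [P] needs. *)
  have H i : computable1 (fun c =>
     peval (cenv (csnd c)) (pr (nth triv_rule P (cfst c - i)))).
    elim: P i => [|r P' IH] i.
      have := computable1_peval (pr triv_rule); apply: computable1_ext => c.
      by rewrite nth_nil.
    have := @computable1_case (fun c => (cfst c - i)) _
       (fun _ c => peval (cenv (csnd c)) (pr (nth triv_rule P' (cfst c - i.+1))))
      (computable_sub (computable_cfst computable1_id) (computable_const _ _))
      (computable1_peval (pr r)).
    move=> /(_ (computable1_comp (IH i.+1) (computable_csnd computable1_id))).
    apply: computable1_ext => c; rewrite subnS.
    by case: (cfst c - i).
  by have := H 0; apply: computable1_ext => c; rewrite subn0.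
eexists; split; last by move=> x; apply: gen_enumP.
exact: computable1_gen_enum.
Qed.

End Horn.

(** * Enumeration of theorems *)

#[local] Arguments cpair : simpl never.
#[local] Opaque cpair cfst csnd.

Lemma tcode_inj : injective tcode.
Proof.
elim=> [n||t IH|t IHt u IHu|t IHt u IHu] [m||t'|t' u'|t' u'] //=;
  move=> /cpair_inj [] // _.
- by move=> ->.
- by move=> /IH ->.
- by move=> /cpair_inj [/IHt -> /IHu ->].
- by move=> /cpair_inj [/IHt -> /IHu ->].
Qed.

Lemma fcode_inj : injective fcode.
Proof.
elim=> [|t u|A IHA B IHB|A IH] [|t' u'|A' B'|A'] //=;
  move=> /cpair_inj [] // _.
- by move=> /cpair_inj [/tcode_inj -> /tcode_inj ->].
- by move=> /cpair_inj [/IHA -> /IHB ->].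
- by move=> /IH ->.
Qed.

Definition scons (t : term) (s : nat -> term) (n : nat) : term :=
  if n is n'.+1 then s n' else t.

Section Rules.

Local Notation "x ;; y" := (PPair x y) (at level 60, right associativity).
Local Notation X n := (PVar n).
Local Notation K n := (PConst n).

Local Notation isTerm x := (K 1;; x).
Local Notation isForm x := (K 2;; x).
Local Notation varSub p k n t := (K 3;; p;; k;; n;; t).
Local Notation termSub p k t u := (K 4;; p;; k;; t;; u).
Local Notation formSub p k a b := (K 5;; p;; k;; a;; b).
Local Notation isInst a t b := (K 6;; a;; t;; b).
Local Notation isProv a := (K 7;; a).
Local Notation output w := (K 8;; w).
Local Notation pVar x := (K 0;; x).
Local Notation pZero := (K 1;; K 0).
Local Notation pSucc x := (K 2;; x).
Local Notation pAdd x y := (K 3;; x;; y).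
Local Notation pMul x y := (K 4;; x;; y).
Local Notation pBot := (K 0;; K 0).
Local Notation pEq x y := (K 1;; x;; y).
Local Notation pImp x y := (K 2;; x;; y).
Local Notation pAll x := (K 3;; x).
Local Notation none := (K 0).

(* The parameter [p] of the substitution judgements is [0] for the shift and
   [(tcode t).+1] for the instantiation by [t]; [k] is the number of binders
   crossed.  The comments number the rules. *)
Definition prov_rules : seq rule := [::
  (* 0 *)
  (isTerm (pVar (X 0)), none, none);
  (isTerm pZero, none, none);
  (isTerm (pSucc (X 0)), isTerm (X 0), none);
  (isTerm (pAdd (X 0) (X 1)), isTerm (X 0), isTerm (X 1));
  (isTerm (pMul (X 0) (X 1)), isTerm (X 0), isTerm (X 1));
  (* 5 *)
  (isForm pBot, none, none);
  (isForm (pEq (X 0) (X 1)), isTerm (X 0), isTerm (X 1));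
  (isForm (pImp (X 0) (X 1)), isForm (X 0), isForm (X 1));
  (isForm (pAll (X 0)), isForm (X 0), none);
  (* 9 *)
  (varSub (K 0) (K 0) (X 0) (pVar (PSucc (X 0))), none, none);
  (varSub (PSucc (X 0)) (K 0) (K 0) (X 0), none, none);
  (varSub (PSucc (X 0)) (K 0) (PSucc (X 1)) (pVar (X 1)), none, none);
  (varSub (X 0) (PSucc (X 1)) (K 0) (pVar (K 0)), none, none);
  (varSub (X 0) (PSucc (X 1)) (PSucc (X 2)) (X 4),
     varSub (X 0) (X 1) (X 2) (X 3), termSub (K 0) (K 0) (X 3) (X 4));
  (* 14 *)
  (termSub (X 0) (X 1) (pVar (X 2)) (X 3),
     varSub (X 0) (X 1) (X 2) (X 3), none);
  (termSub (X 0) (X 1) pZero pZero, none, none);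
  (termSub (X 0) (X 1) (pSucc (X 2)) (pSucc (X 3)),
     termSub (X 0) (X 1) (X 2) (X 3), none);
  (termSub (X 0) (X 1) (pAdd (X 2) (X 3)) (pAdd (X 4) (X 5)),
     termSub (X 0) (X 1) (X 2) (X 4), termSub (X 0) (X 1) (X 3) (X 5));
  (termSub (X 0) (X 1) (pMul (X 2) (X 3)) (pMul (X 4) (X 5)),
     termSub (X 0) (X 1) (X 2) (X 4), termSub (X 0) (X 1) (X 3) (X 5));
  (* 19 *)
  (formSub (X 0) (X 1) pBot pBot, none, none);
  (formSub (X 0) (X 1) (pEq (X 2) (X 3)) (pEq (X 4) (X 5)),
     termSub (X 0) (X 1) (X 2) (X 4), termSub (X 0) (X 1) (X 3) (X 5));
  (formSub (X 0) (X 1) (pImp (X 2) (X 3)) (pImp (X 4) (X 5)),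
     formSub (X 0) (X 1) (X 2) (X 4), formSub (X 0) (X 1) (X 3) (X 5));
  (formSub (X 0) (X 1) (pAll (X 2)) (pAll (X 3)),
     formSub (X 0) (PSucc (X 1)) (X 2) (X 3), none);
  (* 23 *)
  (isInst (X 0) (X 1) (X 2),
     isTerm (X 1), formSub (PSucc (X 1)) (K 0) (X 0) (X 2));
  (output (PApp (X 0)), none, none);
  (* 25 *)
  (isProv (X 0), output (PSucc (X 0)), none);
  (isProv (pImp (X 0) (pImp (X 1) (X 0))), isForm (X 0), isForm (X 1));
  (isProv (pImp (pImp (X 0) (pImp (X 1) (X 2)))
                (pImp (pImp (X 0) (X 1)) (pImp (X 0) (X 2)))),
     isForm (X 0), isForm (pImp (X 1) (X 2)));
  (isProv (pImp (pImp (pImp (X 0) pBot) pBot) (X 0)), isForm (X 0), none);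
  (isProv (pImp (pAll (X 0)) (X 2)), isInst (X 0) (X 1) (X 2), none);
  (* 30 *)
  (isProv (pImp (pAll (pImp (X 0) (X 1))) (pImp (pAll (X 0)) (pAll (X 1)))),
     isForm (X 0), isForm (X 1));
  (isProv (pImp (X 0) (pAll (X 1))), formSub (K 0) (K 0) (X 0) (X 1), none);
  (isProv (pEq (X 0) (X 0)), isTerm (X 0), none);
  (isProv (pImp (pEq (X 1) (X 2)) (pImp (X 3) (X 4))),
     isInst (X 0) (X 1) (X 3), isInst (X 0) (X 2) (X 4));
  (* 34 *)
  (isProv (X 1), isProv (pImp (X 0) (X 1)), isProv (X 0));
  (isProv (pAll (X 0)), isProv (X 0), none)
].

End Rules.

Section Provability.

Variables (T : form -> Prop) (h : nat -> nat).
Hypothesis Th :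
  forall n, (exists A, T A /\ fcode A = n) <-> exists w, h w = n.+1.

Definition sub_param (p : nat) (s : nat -> term) : Prop :=
  if p is q.+1 then exists t, q = tcode t /\ s = scons t Var
  else s = (fun n => Var n.+1).

(** The invariant for soundness of the rules. Substitution judgements are conditional on
    [sub_param], since the rules accept any number as parameter. Tag 0 includes the padding
    judgement and claims nothing. *)
Definition meaning (tag a : nat) : Prop :=
  let x1 := cfst a in let a1 := csnd a in
  let x2 := cfst a1 in let a2 := csnd a1 in
  let x3 := cfst a2 in let x4 := csnd a2 in
  match tag with
  | 1 => exists t, a = tcode t
  | 2 => exists A, a = fcode A
  | 3 => forall s, sub_param x1 s -> x4 = tcode (iter x2 up s x3)
  | 4 => exists t, x3 = tcode t /\
      forall s, sub_param x1 s -> x4 = tcode (tsubst (iter x2 up s) t)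
  | 5 => exists A, x3 = fcode A /\
      forall s, sub_param x1 s -> x4 = fcode (subst (iter x2 up s) A)
  | 6 => exists A t, [/\ x1 = fcode A, x2 = tcode t & a2 = fcode (inst A t)]
  | 7 => exists A, a = fcode A /\ provable T A
  | 8 => exists w, a = h w
  | _ => True
  end.

(** Needed for modus ponens and for scheme [PrS], whose three formulas fit into two premises only by
    asking that an implication be a formula. *)
Lemma fcode_Imp_inv A a b : fcode A = cpair 2 (cpair a b) ->
  exists B C, [/\ A = Imp B C, a = fcode B & b = fcode C].
Proof.
case: A => [|t u|B C|B] /cpair_inj [] // _ /cpair_inj [<- <-].
by exists B, C.
Qed.

Lemma prov_rules_sound x :
  derivable h prov_rules x -> meaning (cfst x) (csnd x).
Proof.
move: x; apply: (@derivable_sound h prov_rules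
  (fun x => meaning (cfst x) (csnd x))) => [//|i env].
(* One split per rule; the remaining index is past the end and reads [triv_rule]. *)
do 36 (try (case: i => [|i])).
all: rewrite /= ?nth_nil /= ?(cfst_cpair, csnd_cpair).
all: rewrite /meaning /= ?(cfst_cpair, csnd_cpair) /=.
all: try by [].
- by move=> _ _; exists (Var (env 0)).
- by move=> _ _; exists Zero.
- by move=> [t ->] _; exists (Succ t).
- by move=> [t ->] [u ->]; exists (Add t u).
- by move=> [t ->] [u ->]; exists (Mul t u).
- by move=> _ _; exists Bot.
- by move=> [t ->] [u ->]; exists (Eq t u).
- by move=> [A ->] [B ->]; exists (Imp A B).
- by move=> [A ->] _; exists (All A).
- by move=> _ _ s ->.
- by move=> _ _ s [t [-> ->]].
- by move=> _ _ s [t [_ ->]].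
- move=> H [t [Et H4]] s Hs; rewrite (H4 (fun n => Var n.+1)) //.
  by move: Et; rewrite (H s Hs) => /tcode_inj <-.
- by move=> H _; exists (Var (env 2)).
- by move=> _ _; exists Zero.
- by move=> [t [-> H]] _; exists (Succ t); split=> // s /H ->.
- move=> [t [-> H]] [u [-> H']]; exists (Add t u); split=> // s Hs.
  by rewrite /= (H s) // (H' s).
- move=> [t [-> H]] [u [-> H']]; exists (Mul t u); split=> // s Hs.
  by rewrite /= (H s) // (H' s).
- by move=> _ _; exists Bot.
- move=> [t [-> H]] [u [-> H']]; exists (Eq t u); split=> // s Hs.
  by rewrite /= (H s) // (H' s).
- move=> [A [-> H]] [B [-> H']]; exists (Imp A B); split=> // s Hs.
  by rewrite /= (H s) // (H' s).
- move=> [A [-> H]] _; exists (All A); split=> // s Hs.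
  by rewrite /= (H s).
- move=> [t ->] [A [-> H]]; exists A, t; split=> //.
  by apply: (H (scons t Var)); exists t.
- by move=> _ _; exists (env 0).
- move=> [w Hw] _; have [|A [TA <-]] := (Th (env 0)).2; first by exists w.
  by exists A; split=> //; apply: PrAx.
- move=> [A ->] [B ->]; exists (Imp A (Imp B A)); split=> //; exact: PrK.
- move=> [A ->] [_ /esym/fcode_Imp_inv [B [C [_ -> ->]]]].
  exists (Imp (Imp A (Imp B C)) (Imp (Imp A B) (Imp A C))); split=> //.
  exact: PrS.
- move=> [A ->] _; exists (Imp (Neg (Neg A)) A); split=> //; exact: PrDN.
- move=> [A [t [-> _ ->]]] _; exists (Imp (All A) (inst A t)); split=> //.
  exact: PrInst.
- move=> [A ->] [B ->].
  exists (Imp (All (Imp A B)) (Imp (All A) (All B))); split=> //; exact: PrDist.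
- move=> [A [-> H]] _; exists (Imp A (All (fshift A))); split; last exact: PrVac.
  by rewrite (H (fun n => Var n.+1)).
- move=> [t ->] _; exists (Eq t t); split=> //; exact: PrRefl.
- move=> [A [t [-> -> ->]]] [B [u [/fcode_inj <- -> ->]]].
  exists (Imp (Eq t u) (Imp (inst A t) (inst A u))); split=> //; exact: PrLeibniz.
- move=> [_ [/esym/fcode_Imp_inv [A [B [-> -> ->]]] H1]] [A' [/fcode_inj <- H2]].
  by exists B; split=> //; apply: PrMP H1 H2.
- move=> [A [-> H]] _; exists (All A); split=> //; exact: PrGen.
Qed.

Local Notation D x := (derivable h prov_rules x).

Lemma D0 : D 0. Proof. exact: gen_base. Qed.
#[local] Hint Resolve D0 : core.

Local Ltac rule i env :=
  move: (@der_rule h prov_rules i env) => /=; apply.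

Lemma D_term t : D (cpair 1 (tcode t)).
Proof.
elim: t => [n||t IH|t IHt u IHu|t IHt u IHu] /=.
- by rule 0 [:: n].
- by rule 1 (Nil nat).
- by rule 2 [:: tcode t].
- by rule 3 [:: tcode t; tcode u].
- by rule 4 [:: tcode t; tcode u].
Qed.

Lemma D_form A : D (cpair 2 (fcode A)).
Proof.
elim: A => [|t u|A IHA B IHB|A IH] /=.
- by rule 5 (Nil nat).
- by rule 6 [:: tcode t; tcode u]; exact: D_term.
- by rule 7 [:: fcode A; fcode B].
- by rule 8 [:: fcode A].
Qed.

(** The variable case is left as a hypothesis because [D_varSub] itself uses this lemma, for the
    shift performed by [up]. *)
Lemma D_termSub p k s t :
  (forall n, D (cpair 3 (cpair p (cpair k (cpair n (tcode (s n))))))) ->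
  D (cpair 4 (cpair p (cpair k (cpair (tcode t) (tcode (tsubst s t)))))).
Proof.
move=> H; elim: t => [n||t IH|t IHt u IHu|t IHt u IHu] /=.
- by rule 14 [:: p; k; n; tcode (s n)].
- by rule 15 [:: p; k].
- by rule 16 [:: p; k; tcode t; tcode (tsubst s t)].
- by rule 17 [:: p; k; tcode t; tcode u; tcode (tsubst s t); tcode (tsubst s u)].
- by rule 18 [:: p; k; tcode t; tcode u; tcode (tsubst s t); tcode (tsubst s u)].
Qed.

Lemma D_varSub p s k n : sub_param p s ->
  D (cpair 3 (cpair p (cpair k (cpair n (tcode (iter k up s n)))))).
Proof.
move=> Hs; elim: k n => [|k IH] n.
  case: p Hs => [->|q [t [-> ->]]] /=; first by rule 9 [:: n].
  case: n => [|n] /=; first by rule 10 [:: tcode t].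
  by rule 11 [:: tcode t; n].
case: n => [|n]; first by rule 12 [:: p; k].
rewrite iterS /=.
rule 13 [:: p; k; n; tcode (iter k up s n); tcode (shift 1 (iter k up s n))] => //.
by apply: D_termSub => m; rule 9 [:: m].
Qed.

Lemma D_formSub p s k A : sub_param p s ->
  D (cpair 5 (cpair p (cpair k
      (cpair (fcode A) (fcode (subst (iter k up s) A)))))).
Proof.
move=> Hs; elim: A k => [|t u|A IHA B IHB|A IH] k /=.
- by rule 19 [:: p; k].
- rule 20 [:: p; k; tcode t; tcode u; tcode (tsubst (iter k up s) t);
     tcode (tsubst (iter k up s) u)];
  by apply: D_termSub => n; apply: D_varSub.
- by rule 21 [:: p; k; fcode A; fcode B; fcode (subst (iter k up s) A);
     fcode (subst (iter k up s) B)].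
- by rule 22 [:: p; k; fcode A; fcode (subst (iter k.+1 up s) A)] => //; apply: IH.
Qed.

Lemma D_inst A t :
  D (cpair 6 (cpair (fcode A) (cpair (tcode t) (fcode (inst A t))))).
Proof.
rule 23 [:: fcode A; tcode t; fcode (inst A t)]; first exact: D_term.
by apply: (@D_formSub _ (scons t Var) 0); exists t.
Qed.

Lemma D_provable A : provable T A -> D (cpair 7 (fcode A)).
Proof.
elim=> {A} /=.
- move=> A TA; have [|w Hw] := (Th (fcode A)).1; first by exists A.
  rule 25 [:: fcode A] => //; rewrite -Hw.
  by rule 24 [:: w].
- by move=> A B; rule 26 [:: fcode A; fcode B]; exact: D_form.
- move=> A B C; rule 27 [:: fcode A; fcode B; fcode C]; first exact: D_form.
  exact: (D_form (Imp B C)).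
- by move=> A; rule 28 [:: fcode A] => //; exact: D_form.
- by move=> A t; rule 29 [:: fcode A; tcode t; fcode (inst A t)] => //; exact: D_inst.
- by move=> A B; rule 30 [:: fcode A; fcode B]; exact: D_form.
- move=> A; rule 31 [:: fcode A; fcode (fshift A)] => //.
  exact: (@D_formSub 0 (fun n => Var n.+1) 0).
- by move=> t; rule 32 [:: tcode t] => //; exact: D_term.
- move=> A t u; rule 33 [:: fcode A; tcode t; tcode u;
    fcode (inst A t); fcode (inst A u)];
  exact: D_inst.
- by move=> A B _ IH1 _ IH2; rule 34 [:: fcode A; fcode B].
- by move=> A _ IH; rule 35 [:: fcode A].
Qed.

Lemma derivable_provable A : D (cpair 7 (fcode A)) <-> provable T A.
Proof.
split; last exact: D_provable.
move=> /prov_rules_sound; rewrite cfst_cpair csnd_cpair.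
by move=> [B [/fcode_inj ->]].
Qed.

End Provability.

Lemma provable_enum (T : form -> Prop) : re_theory T -> exists E : nat -> nat,
  computable1 E /\ forall A, provable T A <-> exists n, E n = cpair 7 (fcode A).
Proof.
move=> /re_enum [h [Hh Th]].
have [E [HE DE]] := derivable_enum Hh prov_rules.
by exists E; split=> // A; rewrite -(derivable_provable Th) DE.
Qed.

(** * The Hilbert calculus and Robinson arithmetic *)

Lemma eq_tsubst s r t : s =1 r -> tsubst s t = tsubst r t.
Proof. by move=> E; elim: t => //= [t ->|t -> u ->|t -> u ->]. Qed.

Lemma eq_up s r : s =1 r -> up s =1 up r.
Proof. by move=> E [|n] //=; rewrite E. Qed.

Lemma eq_subst s r A : s =1 r -> subst s A = subst r A.
Proof.
elim: A s r => [|t u|A IHA B IHB|A IH] s r E //=.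
- by rewrite !(eq_tsubst _ E).
- by rewrite (IHA _ _ E) (IHB _ _ E).
- by rewrite (IH _ _ (eq_up E)).
Qed.

Lemma tsubst_comp s r t :
  tsubst s (tsubst r t) = tsubst (fun n => tsubst s (r n)) t.
Proof. by elim: t => //= [t ->|t -> u ->|t -> u ->]. Qed.

Lemma tsubst_id t : tsubst Var t = t.
Proof. by elim: t => //= [t ->|t -> u ->|t -> u ->]. Qed.

Lemma shiftE s k t : tsubst s (shift k t) = tsubst (fun n => s (k + n)) t.
Proof. exact: tsubst_comp. Qed.

Lemma tsubst_shift1 s t : tsubst (up s) (shift 1 t) = shift 1 (tsubst s t).
Proof. by rewrite shiftE /shift tsubst_comp. Qed.

Lemma tsubst_scons_shift1 u s t : tsubst (scons u s) (shift 1 t) = tsubst s t.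
Proof. by rewrite shiftE. Qed.

Lemma shift0 t : shift 0 t = t.
Proof. exact: tsubst_id. Qed.

Lemma shift_shift j k t : shift j (shift k t) = shift (j + k) t.
Proof. by rewrite {1}/shift shiftE; apply: eq_tsubst => n; rewrite addnA. Qed.

Lemma subst_comp s r A :
  subst s (subst r A) = subst (fun n => tsubst s (r n)) A.
Proof.
elim: A s r => [|t u|A IHA B IHB|A IH] s r //=; rewrite ?tsubst_comp //.
  by rewrite IHA IHB.
rewrite IH; congr All; apply: eq_subst => -[|n] //=; exact: tsubst_shift1.
Qed.

(** Instantiating under a substitution is one simultaneous substitution. Evaluating quantified
    formulas at numerals therefore only extends an environment. *)
Lemma inst_up s A t : inst (subst (up s) A) t = subst (scons t s) A.
Proof.
rewrite /inst subst_comp; apply: eq_subst => -[|n] //=.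
rewrite -[LHS]/(tsubst (scons t Var) (shift 1 (s n))).
by rewrite tsubst_scons_shift1 tsubst_id.
Qed.

Lemma subst_inst s A t : subst s (inst A t) = inst (subst (up s) A) (tsubst s t).
Proof. by rewrite inst_up /inst subst_comp; apply: eq_subst => -[|n]. Qed.

Lemma subst_fshift s A : subst (up s) (fshift A) = fshift (subst s A).
Proof. by rewrite /fshift !subst_comp. Qed.

Lemma bounded_subst k A s :
  bounded k A -> (forall i, i < k -> s i = Var i) -> subst s A = A.
Proof.
have tb j t r : tbounded j t -> (forall i, i < j -> r i = Var i) -> tsubst r t = t.
  move=> H E; elim: t H => [n||t IH|t IHt u IHu|t IHt u IHu] //=.
  - exact: E.
  - by move=> /IH ->.
  - by move=> /andP[/IHt -> /IHu ->].
  - by move=> /andP[/IHt -> /IHu ->].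
elim: A k s => [|t u|A IHA B IHB|A IH] k s //=.
- by move=> /andP[Ht Hu] E; rewrite !(tb k).
- by move=> /andP[HA HB] E; rewrite (IHA k) // (IHB k).
- move=> HA E; congr All; apply: (IH k.+1) => // -[|i] //= Hi.
  by rewrite E.
Qed.

Lemma tsubst_num s n : tsubst s (num n) = num n.
Proof. by elim: n => //= n ->. Qed.

Section Hilbert.

Variable T : form -> Prop.
Hypothesis hT : theory T.

Local Notation "|- A" := (provable T A) (at level 99).

(** Axioms of T are sentences, hence fixed by substitution, and the logical schemes are closed under
    it. This weakens theorems under new binders. *)
Lemma provable_subst A s : |- A -> |- subst s A.
Proof.
move=> H; elim: H s => {A} /=.
- move=> A TA s; rewrite (bounded_subst (hT TA)) //; exact: PrAx.
- move=> *; exact: PrK.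
- move=> *; exact: PrS.
- move=> *; exact: PrDN.
- move=> A t s; rewrite subst_inst; exact: PrInst.
- move=> *; exact: PrDist.
- move=> A s; rewrite subst_fshift; exact: PrVac.
- move=> *; exact: PrRefl.
- move=> A t u s; rewrite !subst_inst; exact: PrLeibniz.
- move=> A B _ IH1 _ IH2 s; exact: PrMP (IH1 s) (IH2 s).
- move=> A _ IH s; exact: PrGen.
Qed.

(** Hypotheses are curried implications instead of added axioms, so they may be open although
    generalization is unrestricted. *)
Definition ded (G : seq form) (A : form) : Prop := |- foldr Imp A G.

Lemma ded_lift G A : |- A -> ded G A.
Proof. by move=> H; elim: G => //= B G IH; apply: PrMP IH; exact: PrK. Qed.

Lemma imp_trans A B C : |- Imp A B -> |- Imp B C -> |- Imp A C.
Proof.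
move=> H1 H2; apply: PrMP H1; apply: PrMP (PrS _ _ _ _) _.
by apply: PrMP H2; exact: PrK.
Qed.

Lemma ded_mp G A B : ded G (Imp A B) -> ded G A -> ded G B.
Proof.
move=> H1 H2; apply: PrMP H2; apply: PrMP H1.
elim: G => [|C G IH] /=.
  have I X : |- Imp X X.
    by apply: PrMP (PrK T X X); apply: PrMP (PrK T X (Imp X X)); exact: PrS.
  exact: I.
apply: imp_trans (PrS T C _ _); apply: PrMP (PrS _ _ _ _) _.
by apply: PrMP IH; exact: PrK.
Qed.

Lemma ded_intro G A B : ded (rcons G A) B -> ded G (Imp A B).
Proof. by rewrite /ded foldr_rcons. Qed.

Lemma ded_hyp G i : i < size G -> ded G (nth Bot G i).
Proof.
elim: G i => [|A G IH] [|i] //= Hi; last first.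
  by apply: PrMP (IH i Hi); exact: PrK.
elim: G {IH Hi} => [|B G IH] /=.
  by apply: PrMP (PrK T A A); apply: PrMP (PrK T A (Imp A A)); exact: PrS.
by apply: imp_trans IH _; exact: PrK.
Qed.

Lemma ded_DN G A : ded (rcons G (Neg A)) Bot -> ded G A.
Proof. by move=> /ded_intro; apply: ded_mp; apply: ded_lift; exact: PrDN. Qed.

Lemma And_intro A B : |- A -> |- B -> |- And A B.
Proof.
move=> HA HB; apply: (@ded_intro [::]); apply: ded_mp (ded_lift _ HB).
by apply: ded_mp (ded_lift _ HA); exact: (@ded_hyp _ 0).
Qed.

Lemma subst_And_intro s A B :
  |- subst s A -> |- subst s B -> |- subst s (And A B).
Proof. exact: And_intro. Qed.

Lemma Neg_cases A C : |- Imp A C -> |- Imp (Neg A) C -> |- C.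
Proof.
move=> H1 H2.
apply: (@ded_DN [::]); apply: (@ded_mp _ C); first exact: (@ded_hyp _ 0).
apply: ded_mp (ded_lift _ H2) _.
apply: (@ded_intro [:: Neg C]); apply: (@ded_mp _ C).
  exact: (@ded_hyp _ 0).
by apply: ded_mp (ded_lift _ H1) _; exact: (@ded_hyp _ 1).
Qed.

Lemma Ex_intro A t : |- inst A t -> |- Ex A.
Proof.
move=> H; apply: (@ded_intro [::]); apply: ded_mp (ded_lift _ H).
apply: ded_mp (ded_lift _ (PrInst T (Neg A) t)) _; exact: (@ded_hyp _ 0).
Qed.

(** Contrapose, generalize, and introduce the vacuous quantifier by [PrVac]. *)
Lemma Ex_elim A B : |- Imp A (fshift B) -> |- Imp (Ex A) B.
Proof.
move=> H; have {}H : |- Imp (fshift (Neg B)) (Neg A).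
  apply: (@ded_intro [:: Neg (fshift B)]).
  apply: (@ded_mp _ (fshift B)); first exact: (@ded_hyp _ 0).
  by apply: ded_mp (ded_lift _ H) _; exact: (@ded_hyp _ 1).
have {}H := imp_trans (PrVac T (Neg B)) (PrMP (PrDist T _ _) (PrGen H)).
apply: (@ded_DN [:: _]); apply: (@ded_mp _ (All (Neg A))).
  exact: (@ded_hyp _ 0).
by apply: ded_mp (ded_lift _ H) _; exact: (@ded_hyp _ 1).
Qed.

Lemma All_elim2 A t u : |- All (All A) -> |- subst (scons u (scons t Var)) A.
Proof.
move=> H; have H1 := PrMP (PrInst T _ t) H.
by have := PrMP (PrInst T _ u) H1; rewrite inst_up.
Qed.

Lemma eq_leib A s t u :
  |- Imp (Eq t u) (Imp (subst (scons t s) A) (subst (scons u s) A)).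
Proof. by have := PrLeibniz T (subst (up s) A) t u; rewrite !inst_up. Qed.

Lemma ded_eq_leib G A s t u : ded G (Eq t u) -> ded G (subst (scons t s) A) ->
  ded G (subst (scons u s) A).
Proof.
by move=> H1; apply: ded_mp; apply: ded_mp H1; apply: ded_lift; exact: eq_leib.
Qed.

Lemma ded_eq_sym G t u : ded G (Eq t u) -> ded G (Eq u t).
Proof.
move=> H; apply: (ded_eq_leib (A := Eq (Var 0) (Var 1)) (s := fun=> t) H).
by apply: ded_lift; exact: PrRefl.
Qed.

Lemma ded_eq_trans G t u v : ded G (Eq t u) -> ded G (Eq u v) -> ded G (Eq t v).
Proof.
by move=> H /(ded_eq_leib (A := Eq (Var 1) (Var 0)) (s := fun=> t)); apply.
Qed.

Lemma ded_eq_succ G t u : ded G (Eq t u) -> ded G (Eq (Succ t) (Succ u)).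
Proof.
move=> H; apply: (ded_eq_leib (A := Eq (Var 1) (Succ (Var 0)))
  (s := fun=> Succ t) H).
by apply: ded_lift; exact: PrRefl.
Qed.

Lemma ded_eq_add G t u t' u' : ded G (Eq t t') -> ded G (Eq u u') ->
  ded G (Eq (Add t u) (Add t' u')).
Proof.
move=> H H'; apply: (ded_eq_leib (A := Eq (Var 1) (Add (Var 2) (Var 0)))
  (s := scons (Add t u) (fun=> t')) H').
apply: (ded_eq_leib (A := Eq (Var 1) (Add (Var 0) (Var 2)))
  (s := scons (Add t u) (fun=> u)) H).
by apply: ded_lift; exact: PrRefl.
Qed.

Lemma ded_eq_mul G t u t' u' : ded G (Eq t t') -> ded G (Eq u u') ->
  ded G (Eq (Mul t u) (Mul t' u')).
Proof.
move=> H H'; apply: (ded_eq_leib (A := Eq (Var 1) (Mul (Var 2) (Var 0)))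
  (s := scons (Mul t u) (fun=> t')) H').
apply: (ded_eq_leib (A := Eq (Var 1) (Mul (Var 0) (Var 2)))
  (s := scons (Mul t u) (fun=> u)) H).
by apply: ded_lift; exact: PrRefl.
Qed.

Hypothesis hQ : subtheory Q T.

Lemma q1 t : |- Neg (Eq (Succ t) Zero).
Proof. exact: PrMP (PrInst _ _ t) (PrAx (hQ Q1)). Qed.

Lemma q2 t u : |- Imp (Eq (Succ t) (Succ u)) (Eq t u).
Proof. exact: All_elim2 t u (PrAx (hQ Q2)). Qed.

Lemma q3 t : |- Imp (Neg (Eq t Zero)) (Ex (Eq (shift 1 t) (Succ (Var 0)))).
Proof. exact: PrMP (PrInst _ _ t) (PrAx (hQ Q3)). Qed.

Lemma q4 t : |- Eq (Add t Zero) t.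
Proof. exact: PrMP (PrInst _ _ t) (PrAx (hQ Q4)). Qed.

Lemma q5 t u : |- Eq (Add t (Succ u)) (Succ (Add t u)).
Proof. exact: All_elim2 t u (PrAx (hQ Q5)). Qed.

Lemma q6 t : |- Eq (Mul t Zero) Zero.
Proof. exact: PrMP (PrInst _ _ t) (PrAx (hQ Q6)). Qed.

Lemma q7 t u : |- Eq (Mul t (Succ u)) (Add (Mul t u) t).
Proof. exact: All_elim2 t u (PrAx (hQ Q7)). Qed.

Definition value (t : term) (n : nat) : Prop := |- Eq t (num n).

Lemma value_num n : value (num n) n.
Proof. exact: PrRefl. Qed.

Lemma value_succ t n : value t n -> value (Succ t) n.+1.
Proof. exact: (@ded_eq_succ [::]). Qed.

Lemma value_add t u m n : value t m -> value u n -> value (Add t u) (m + n).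
Proof.
move=> Ht Hu; apply: (@ded_eq_trans [::]) (@ded_eq_add [::] _ _ _ _ Ht Hu) _.
rewrite /ded /=; elim: n {Hu} => [|n IH]; first by rewrite addn0; exact: q4.
rewrite addnS; apply: (@ded_eq_trans [::]) (q5 _ _) _.
exact: (@ded_eq_succ [::]).
Qed.

Lemma value_mul t u m n : value t m -> value u n -> value (Mul t u) (m * n).
Proof.
move=> Ht Hu; apply: (@ded_eq_trans [::]) (@ded_eq_mul [::] _ _ _ _ Ht Hu) _.
rewrite /ded /=; elim: n {Hu} => [|n IH]; first by rewrite muln0; exact: q6.
rewrite mulnS addnC; apply: (@ded_eq_trans [::]) (q7 _ _) _.
exact: value_add IH (value_num m).
Qed.

Lemma value_eq t u n : value t n -> value u n -> |- Eq t u.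
Proof.
by move=> Ht Hu; apply: (@ded_eq_trans [::]) Ht _; apply: (@ded_eq_sym [::]).
Qed.

Lemma provable_fle t u m n : value t m -> value u n -> m <= n -> |- fle t u.
Proof.
move=> Ht Hu Hmn; apply: (@Ex_intro _ (num (n - m))).
rewrite /inst /= -!/(scons _ Var) !tsubst_scons_shift1 !tsubst_id.
by apply: value_eq Hu; have := value_add (value_num (n - m)) Ht; rewrite subnK.
Qed.

(* Induction on [k]; Q3 splits into the cases [x = 0] and [x = S x']. *)
Lemma lt_num_elim k z x C : (forall i, i < k -> |- Imp (Eq x (num i)) C) ->
  |- Imp (Eq (Add z (Succ x)) (num k)) C.
Proof.
elim: k z x C => [|k IH] z x C H.
  apply: (@ded_DN [:: _]); apply: ded_mp (ded_lift _ (q1 (Add z x))) _.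
  apply: ded_eq_trans (@ded_hyp [:: _; _] 0 isT).
  by apply: ded_eq_sym; apply: ded_lift; exact: q5.
(* Q5 and Q2 reduce the equation to [z + x = k]; no commutativity of addition is needed, because the
   variable to be split is the right summand. *)
have {}IH : |- Imp (Eq (Add z x) (num k)) C.
  apply: (@Neg_cases (Eq x Zero)).
    apply: (@ded_intro [:: _]); apply: ded_mp (ded_lift _ (H 0 isT)) _.
    exact: (@ded_hyp _ 0).
  apply: (imp_trans (q3 x)); apply: Ex_elim.
  set x' := shift 1 x.
  (* The predecessor of [x] is [Var 0]. The conclusion handed to the induction hypothesis carries
     the equation saying so, which turns predecessor [i] into [x = i.+1]. *)
  have {}IH : |- Imp (Eq (Add (shift 1 z) (Succ (Var 0))) (num k))
      (Imp (Eq x' (Succ (Var 0))) (fshift C)).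
    apply: IH => i Hi; apply: (@ded_intro [:: _]).
    have := provable_subst (fun n => Var n.+1) (H i.+1 Hi).
    rewrite /= tsubst_num => /ded_lift {}H; apply: ded_mp (H _) _.
    apply: ded_eq_trans (@ded_hyp [:: _; _] 1 isT) _.
    by apply: ded_eq_succ; exact: (@ded_hyp _ 0).
  have E : fshift (Imp (Eq (Add z x) (num k)) C) =
      Imp (Eq (Add (shift 1 z) x') (num k)) (fshift C).
    by rewrite /fshift /= tsubst_num.
  rewrite E; apply: (@ded_intro [:: _]).
  apply: ded_mp (@ded_hyp [:: _; _] 0 isT); apply: ded_mp (ded_lift _ IH) _.
  apply: ded_eq_trans (@ded_hyp [:: _; _] 1 isT); apply: ded_eq_add.
    by apply: ded_lift; exact: PrRefl.
  by apply: ded_eq_sym; exact: (@ded_hyp _ 0).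
apply: (imp_trans _ IH); apply: (@ded_mp [:: _]); first exact: ded_lift (q2 _ _).
apply: ded_eq_trans (@ded_hyp [:: _] 0 isT).
by apply: ded_eq_sym; apply: ded_lift; exact: q5.
Qed.

Lemma subst_fle s t u : subst s (fle t u) = fle (tsubst s t) (tsubst s u).
Proof. by rewrite /fle /= !tsubst_shift1. Qed.

(** Stated under a substitution [s] that acts as an environment of numerals: each quantifier passed
    pushes one more, and the nested formulas of [graph] are never rewritten. *)
Lemma bex_le_intro s t A k n : tsubst s t = num n -> k <= n ->
  |- subst (scons (num k) s) A -> |- subst s (bex_le t A).
Proof.
move=> Ht Hk H; pose F := Imp (fle (Var 0) (shift 1 t)) (Neg A).
have E : inst (subst (up s) F) (num k) =
    Imp (fle (num k) (num n)) (Neg (subst (scons (num k) s) A)).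
  rewrite inst_up; set r := scons _ _.
  rewrite -[LHS]/(Imp (subst r (fle (Var 0) (shift 1 t))) (Neg (subst r A))).
  by rewrite subst_fle tsubst_scons_shift1 Ht.
apply: (@ded_intro [::]); apply: ded_mp (ded_lift _ H).
apply: (@ded_mp _ (fle (num k) (num n))).
  have := PrInst T (subst (up s) F) (num k); rewrite E => /ded_lift L.
  by apply: ded_mp (L _) _; exact: (@ded_hyp _ 0).
by apply: ded_lift; apply: provable_fle Hk; exact: value_num.
Qed.

Lemma ball_lt_intro s t A k : tsubst s t = num k ->
  (forall i, i < k -> |- subst (scons (num i) s) A) -> |- subst s (ball_lt t A).
Proof.
move=> Ht H; apply: PrGen.
rewrite -/subst /flt subst_fle tsubst_shift1 Ht; apply: Ex_elim.
rewrite /shift /= !tsubst_num /=; apply: lt_num_elim => i /H {}H.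
(* Two binders have been crossed, the quantified variable and the witness of [flt]; the former is
   now [Var 1]. *)
have E : fshift (subst (up s) A) =
    subst (scons (Var 1) (fun n => shift 2 (s n))) A.
  rewrite /fshift subst_comp; apply: eq_subst => -[|n] //=.
  by rewrite shiftE.
have {}H : provable T (subst (scons (num i) (fun n => shift 2 (s n))) A).
  have := provable_subst (fun n => Var n.+2) H; rewrite subst_comp.
  by congr (provable T _); apply: eq_subst => -[|n] //=; rewrite tsubst_num.
rewrite E; apply: (@ded_intro [::]); apply: ded_eq_leib (ded_lift _ H).
by apply: ded_eq_sym; exact: (@ded_hyp _ 0).
Qed.

Lemma provable_beta s a d i z av dv iv :
  tsubst s a = num av -> tsubst s d = num dv -> tsubst s i = num iv ->
  tsubst s z = num (av %% (iv.+1 * dv).+1) -> |- subst s (beta a d i z).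
Proof.
move=> Ha Hd Hi Hz; set mv := (iv.+1 * dv).+1 in Hz *.
pose m := Succ (Mul (Succ i) d).
have Vm : value (tsubst s m) mv.
  rewrite /m /= Hd Hi.
  exact: value_succ (value_mul (value_num iv.+1) (value_num dv)).
have L : |- subst s (flt z m).
  rewrite /flt subst_fle /= Hz; apply: provable_fle Vm (ltn_pmod av (ltn0Sn _)).
  exact: (value_num (av %% mv).+1).
have R : |- subst s (bex_le a
    (Eq (shift 1 a) (Add (Mul (Var 0) (shift 1 m)) (shift 1 z)))).
  (* The witness is the quotient of the division, which is at most [av]. *)
  apply: (bex_le_intro (k := av %/ mv) Ha (leq_div _ _)).
  rewrite [X in |- X]/= -/(shift 1 m) !tsubst_scons_shift1 Ha Hz.
  apply: (@value_eq _ _ av); first exact: value_num.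
  have := value_add (value_mul (value_num (av %/ mv)) Vm) (value_num (av %% mv)).
  by rewrite -divn_eq.
exact: And_intro L R.
Qed.

Definition nscons (w : seq nat) (s : nat -> term) : nat -> term :=
  foldr (fun k => scons (num k)) s w.

Lemma nscons_nth w s i : i < size w -> nscons w s i = num (nth 0 w i).
Proof. by elim: w i => [|k w IH] [|i] //= Hi; exact: IH. Qed.

Lemma nscons_shift w s t : tsubst (nscons w s) (shift (size w) t) = tsubst s t.
Proof.
by rewrite shiftE; apply: eq_tsubst => n; elim: w => //= k w ->.
Qed.

(** The outermost of the [m] quantifiers binds variable [m - 1], the last entry of [w]; hence the
    induction from the right. *)
Lemma bexn_le_intro m w s t A n : size w = m -> tsubst s t = num n ->
  (forall k, k \in w -> k <= n) -> |- subst (nscons w s) A ->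
  |- subst s (bexn_le m t A).
Proof.
move=> <-; elim/last_ind: w s t => [|w k IH] s t Ht Hw H //=.
rewrite size_rcons /=; apply: (bex_le_intro Ht).
  by apply: (Hw k); rewrite mem_rcons inE eqxx.
apply: IH.
- by rewrite tsubst_scons_shift1.
- by move=> j Hj; apply: Hw; rewrite mem_rcons inE Hj orbT.
- by move: H; rewrite /nscons foldr_rcons.
Qed.

Lemma bigAnd_intro m (F : 'I_m -> form) s : (forall i, |- subst s (F i)) ->
  |- subst s (\big[And/Top]_(i < m) F i).
Proof.
move=> H; elim/big_rec: _ => [|i A _ IH].
  by apply: (@ded_intro [::]); exact: (@ded_hyp _ 0).
exact: And_intro.
Qed.

End Hilbert.

(** * Sigma_1-completeness *)

(** The gcd divides [(j - i) * d] with [d] the factorial of [N]. Each modulus is prime to [d], and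
    [j - i] divides [d]. *)
Lemma beta_coprime N i j : i < j <= N ->
  coprime (i.+1 * N`!).+1 (j.+1 * N`!).+1.
Proof.
move=> /andP[Hij HjN]; set d := N`!.
have cS k : coprime (k * d).+1 d.
  by rewrite /coprime -addn1 gcdnC gcdnMDl gcdn1.
have E : (j.+1 * d).+1 = (j - i) * d + (i.+1 * d).+1.
  by rewrite addnS -mulnDl; congr (_ * _).+1; lia.
rewrite /coprime E gcdnDr -/(coprime _ _) coprimeMr cS andbT.
have Hd : j - i %| d by apply: dvdn_fact; lia.
exact: coprime_dvdr Hd (cS _).
Qed.

Lemma chinese_seq (m c : nat -> nat) n :
  (forall i j, i < j < n -> coprime (m i) (m j)) ->
  exists a, forall i, i < n -> a = c i %[mod m i].
Proof.
elim: n => [|n IH] Hco; first by exists 0.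
have [|a Ha] := IH; first by move=> i j Hij; apply: Hco; lia.
have co : coprime (\prod_(i < n) m i) (m n).
  elim/big_ind: _ => [|x y Hx Hy|i _]; rewrite ?coprime1n ?coprimeMl ?Hx //=.
  by rewrite Hco // ltnSn ltn_ord.
exists (chinese (\prod_(i < n) m i) (m n) a (c n)) => i.
rewrite ltnS leq_eqVlt => /orP[/eqP ->|Hi]; first exact: chinese_modr.
rewrite -(Ha i Hi); have D : m i %| \prod_(i < n) m i.
  by rewrite (bigD1 (Ordinal Hi)) //= dvdn_mulr.
by rewrite -(modn_dvdm _ D) chinese_modl // modn_dvdm.
Qed.

Lemma beta_seq (c : nat -> nat) n :
  exists a d, forall i, i < n -> c i = a %% (i.+1 * d).+1.
Proof.
(* The summand [n] bounds the indices, for coprimality; the maximum puts each value below its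
   modulus. *)
pose N := n + \max_(i < n) c i;
have [|a Ha] := @chinese_seq (fun i => (i.+1 * N`!).+1) c n.
  by move=> i j Hij; apply: beta_coprime; lia.
exists a, N`! => i Hi; rewrite Ha // modn_small // ltnS.
have : c i <= \max_(i < n) c i by apply: (leq_bigmax (Ordinal Hi)).
have := fact_geq N; have := leq_pmull N`! (ltn0Sn i); lia.
Qed.

Section Sigma1.

Variable T : form -> Prop.
Hypotheses (hT : theory T) (hQ : subtheory Q T).

Local Notation "|- A" := (provable T A) (at level 99).

(** All subcomputations share one bound, so the claim is made for every sufficiently large [B], and
    their thresholds can be added. Substitution and argument terms are arbitrary because [graph]
    occurs under varying numbers of binders. *)
Lemma provable_graph n (f : recf n) v y : eval f v y ->
  exists B0, forall B, B0 <= B -> forall s b xs yt,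
    tsubst s b = num B -> (forall i, tsubst s (tnth xs i) = num (tnth v i)) ->
    tsubst s yt = num y -> |- subst s (graph f b xs yt).
Proof.
elim: f v y => {n}.
- by move=> n v y /= ->; exists 0 => B _ s b xs yt _ _ /= ->; exact: PrRefl.
- move=> v y /= ->; exists 0 => B _ s b xs yt _ Hxs /= ->.
  by rewrite Hxs; exact: PrRefl.
- move=> n i v y /= ->; exists 0 => B _ s b xs yt _ Hxs /= ->.
  by rewrite Hxs; exact: PrRefl.
- move=> n m f IHf gs IHg v y [w [Hw Hf]].
  have [B1 H1] := IHf _ _ Hf.
  have [B2 H2] := eventually_ord (fun i => IHg i _ _ (Hw i)).
  (* The intermediate values are added because [graph] quantifies them below the bound. *)
  exists (B1 + B2 + \sum_(i < m) tnth w i) => B HB s b xs yt Hb Hxs Hy.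
  have Ew : size (tval w) = m := size_tuple w.
  have Sh t : tsubst (nscons w s) (shift m t) = tsubst s t.
    by rewrite -{2}Ew nscons_shift.
  have Vi (i : 'I_m) : tsubst (nscons w s) (Var i) = num (tnth w i).
    by rewrite /= nscons_nth ?Ew // (tnth_nth 0).
  apply: (bexn_le_intro hQ Ew Hb).
    move=> k /tnthP [i ->]; apply: leq_trans HB.
    by rewrite (bigD1 i) //=; lia.
  apply: subst_And_intro.
    apply: bigAnd_intro => i; apply: (H2 B) => //; first lia.
    - by rewrite Sh.
    - by move=> j; rewrite tnth_map Sh.
  apply: (H1 B) => //; first lia.
  - by rewrite Sh.
  - by move=> i; rewrite tnth_mktuple.
  - by rewrite Sh.
- move=> n f IHf g IHg v y /prec_graph_seq [c [/IHf [B1 H1] Hy Hs]].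
  have [B2 H2] := eventually_all (fun i Hi => IHg _ _ (Hs i Hi)).
  set k := thead v in Hy Hs H2 *.
  have [a [d Hc]] := beta_seq c k.+1.
  (* The bound must also exceed the beta code [a], [d] and all the values it codes. *)
  exists (B1 + B2 + a + d + \sum_(i < k.+1) c i) => B HB s b xs yt Hb Hxs Hyt.
  have Hcb i : i <= k -> c i <= B.
    by move=> Hi; move: HB; rewrite (bigD1 (inord i)) //= inordK //; lia.
  have Hk : tsubst s (thead xs) = num k by rewrite Hxs.
  have Hp i :
      tsubst s (tnth (behead_tuple xs) i) = num (tnth (behead_tuple v) i).
    by rewrite !tnth_behead.
  apply: (bex_le_intro hQ Hb (k := a)); first lia.
  apply: (bex_le_intro hQ (k := d) (n := B)); [by rewrite shiftE|lia|].
  apply: subst_And_intro.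
    apply: (bex_le_intro hQ (k := c 0) (n := B));
      [by rewrite shiftE|exact: Hcb|].
    apply: subst_And_intro.
      apply: (provable_beta hQ (av := a) (dv := d) (iv := 0)) => //=.
      by rewrite Hc.
    apply: (H1 B) => //; first lia.
      by rewrite shiftE.
    by move=> i; rewrite tnth_map shiftE.
  apply: subst_And_intro; last first.
    apply: (provable_beta hQ (av := a) (dv := d) (iv := k)) => //=.
      by rewrite shiftE.
    by rewrite shiftE Hyt -Hy Hc.
  apply: (ball_lt_intro hT hQ (k := k)); first by rewrite shiftE.
  move=> i Hi.
  apply: (bex_le_intro hQ (k := c i) (n := B));
    [by rewrite shiftE|by apply: Hcb; lia|].
  apply: (bex_le_intro hQ (k := c i.+1) (n := B));
    [by rewrite shiftE|exact: Hcb|].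
  apply: subst_And_intro.
    apply: (provable_beta hQ (av := a) (dv := d) (iv := i)) => //=.
    by rewrite Hc //; lia.
  apply: subst_And_intro.
    apply: (provable_beta hQ (av := a) (dv := d) (iv := i.+1)) => //=.
    by rewrite Hc.
  apply: (H2 B _ i Hi) => //; first lia.
    by rewrite shiftE.
  move=> j; case: (unliftP ord0 j) => [j'|] ->; last by [].
  rewrite !tnthS; case: (unliftP ord0 j') => [j''|] ->; last by [].
  by rewrite !tnthS tnth_map shiftE.
- move=> n f IHf v y [/IHf [B1 H1] Hlt].
  (* The nonzero value found at each [z < y] is itself a bounded witness, so [k <= B] belongs to the
     threshold property. *)
  have [|B2 H2] := @eventually_all (fun z B => exists2 k, k <= B &
      forall s b xs yt, tsubst s b = num B ->
      (forall i, tsubst s (tnth xs i) = num (tnth (cons_tuple z v) i)) ->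
      tsubst s yt = num k.+1 -> |- subst s (graph f b xs yt)) y.
    move=> z /Hlt [k /IHf [B2 H2]]; exists (k + B2) => B HB; exists k; first lia.
    by apply: H2; lia.
  exists (B1 + B2) => B HB s b xs yt Hb Hxs Hy.
  have Hcons z zt xs' s' : tsubst s' zt = num z ->
     (forall i, tsubst s' (tnth xs' i) = num (tnth v i)) ->
     forall i, tsubst s' (tnth (cons_tuple zt xs') i) =
       num (tnth (cons_tuple z v) i).
    by move=> Hz Hxs' i; case: (unliftP ord0 i) => [j|] ->; rewrite ?tnthS.
  apply: subst_And_intro.
    by apply: (H1 B) => //; [lia|exact: Hcons].
  apply: (ball_lt_intro hT hQ Hy) => z Hz.
  have [|k Hk Hg] := H2 B _ z Hz; first lia.
  apply: (bex_le_intro hQ (k := k) (n := B)) => //; first by rewrite shiftE.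
  apply: Hg => //; first by rewrite shiftE.
  by apply: Hcons => // i; rewrite tnth_map shiftE.
Qed.

Lemma provable_halts e n : W e n n -> |- halts e n.
Proof.
(* In [halts] one variable bounds both the computation and its value, hence the sum. *)
move=> [y /provable_graph [B0 H]]; apply: (@Ex_intro _ _ (num (B0 + y))).
apply: (@bex_le_intro _ hQ (scons (num (B0 + y)) Var) (Var 0) _ y (B0 + y)) => //.
  exact: leq_addl.
apply: (H (B0 + y)) => //; first exact: leq_addr.
move=> i; case: (unliftP ord0 i) => [j|] ->; last by rewrite /= tsubst_num.
by rewrite !tnthS ord1 /= tsubst_num.
Qed.

End Sigma1.

(** * Computability of the coding *)

(** Bounded quantifiers shift their terms; demanding all shifts at once avoids computing with codes
    of shifted terms. *)
Definition computable_term (t : nat -> term) : Prop :=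
  forall k, computable1 (fun x => tcode (shift k (t x))).

Definition computable_form (A : nat -> form) : Prop :=
  computable1 (fun x => fcode (A x)).

Section Coding.

Implicit Types (t u : nat -> term) (A B : nat -> form).

Lemma computable_code c F : computable1 F -> computable1 (fun x => cpair c (F x)).
Proof. by move=> HF; apply: computable_cpair => //; exact: computable_const. Qed.

Lemma computable_code2 c F G : computable1 F -> computable1 G ->
  computable1 (fun x => cpair c (cpair (F x) (G x))).
Proof. by move=> HF HG; apply: computable_code; exact: computable_cpair. Qed.

Lemma computable_Var i : computable_term (fun=> Var i).
Proof. by move=> k; exact: computable_const. Qed.

Lemma computable_Succ t :
  computable_term t -> computable_term (fun x => Succ (t x)).
Proof. by move=> Ht k; exact: (computable_code 2 (Ht k)). Qed.

Lemma computable_Add t u : computable_term t -> computable_term u ->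
  computable_term (fun x => Add (t x) (u x)).
Proof. by move=> Ht Hu k; exact: (computable_code2 3 (Ht k) (Hu k)). Qed.

Lemma computable_Mul t u : computable_term t -> computable_term u ->
  computable_term (fun x => Mul (t x) (u x)).
Proof. by move=> Ht Hu k; exact: (computable_code2 4 (Ht k) (Hu k)). Qed.

Lemma computable_shift j t :
  computable_term t -> computable_term (fun x => shift j (t x)).
Proof.
move=> Ht k; have := Ht (k + j); apply: computable1_ext => x.
by rewrite shift_shift.
Qed.

Lemma computable_num : computable_term num.
Proof.
move=> k; have := @computable1_rec (fun=> cpair 1 0) (fun _ z _ => cpair 2 z) id
  (computable_const _ _) (computable_code _ (computable_cfst
    (computable_csnd computable1_id))) computable1_id.
apply: computable1_ext => n; rewrite /shift tsubst_num.
by elim: n => //= n ->.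
Qed.

Lemma computable_Eq t u : computable_term t -> computable_term u ->
  computable_form (fun x => Eq (t x) (u x)).
Proof.
move=> Ht Hu; have := computable_code2 1 (Ht 0) (Hu 0).
by apply: computable1_ext => x; rewrite !shift0.
Qed.

Lemma computable_Imp A B : computable_form A -> computable_form B ->
  computable_form (fun x => Imp (A x) (B x)).
Proof. exact: computable_code2. Qed.

Lemma computable_Bot : computable_form (fun=> Bot).
Proof. exact: computable_const. Qed.

Lemma computable_Neg A : computable_form A -> computable_form (fun x => Neg (A x)).
Proof. by move=> HA; apply: computable_Imp => //; exact: computable_Bot. Qed.

Lemma computable_All A : computable_form A -> computable_form (fun x => All (A x)).
Proof. exact: computable_code. Qed.

Lemma computable_Ex A : computable_form A -> computable_form (fun x => Ex (A x)).
Proof. by move=> HA; apply/computable_Neg/computable_All/computable_Neg. Qed.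

Lemma computable_And A B : computable_form A -> computable_form B ->
  computable_form (fun x => And (A x) (B x)).
Proof.
by move=> HA HB; apply/computable_Neg/computable_Imp => //; exact: computable_Neg.
Qed.

Lemma computable_fle t u : computable_term t -> computable_term u ->
  computable_form (fun x => fle (t x) (u x)).
Proof.
move=> Ht Hu; apply/computable_Ex/computable_Eq; last exact: computable_shift.
by apply: computable_Add; [exact: computable_Var|exact: computable_shift].
Qed.

Lemma computable_ball_lt t A : computable_term t -> computable_form A ->
  computable_form (fun x => ball_lt (t x) (A x)).
Proof.
move=> Ht HA; apply/computable_All/computable_Imp => //; apply: computable_fle.
  exact: computable_Succ (computable_Var 0).
exact: computable_shift.
Qed.

Lemma computable_bex_le t A : computable_term t -> computable_form A ->
  computable_form (fun x => bex_le (t x) (A x)).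
Proof.
move=> Ht HA; apply/computable_Neg/computable_All/computable_Imp.
  by apply: computable_fle; [exact: computable_Var|exact: computable_shift].
exact: computable_Neg.
Qed.

Lemma computable_bexn_le m t A : computable_term t -> computable_form A ->
  computable_form (fun x => bexn_le m (t x) (A x)).
Proof.
elim: m t A => [|m IH] t A Ht HA //=; apply: computable_bex_le => //.
by apply: IH => //; exact: computable_shift.
Qed.

Lemma computable_bigAnd m (F : 'I_m -> nat -> form) :
  (forall i, computable_form (F i)) ->
  computable_form (fun x => \big[And/Top]_(i < m) F i x).
Proof.
move=> HF; rewrite /computable_form.
have : computable_form (fun x => foldr (fun i => And (F i x)) Top
    (index_enum 'I_m)).
  elim: (index_enum _) => [|i r IH] /=; first exact: computable_const.
  exact: computable_And.
by apply: computable1_ext => x; rewrite unlock.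
Qed.

Lemma computable_beta a d i z : computable_term a -> computable_term d ->
  computable_term i -> computable_term z ->
  computable_form (fun x => beta (a x) (d x) (i x) (z x)).
Proof.
move=> Ha Hd Hi Hz.
have Hm : computable_term (fun x => Succ (Mul (Succ (i x)) (d x))).
  by apply/computable_Succ/computable_Mul => //; exact: computable_Succ.
apply: computable_And.
  by apply: computable_fle => //; exact: computable_Succ.
apply: computable_bex_le => //; apply: computable_Eq; first exact: computable_shift.
apply: computable_Add; last exact: computable_shift.
by apply: computable_Mul; [exact: computable_Var|exact: (computable_shift 1 Hm)].
Qed.

Definition computable_terms n (xs : nat -> n.-tuple term) : Prop :=
  forall i, computable_term (fun x => tnth (xs x) i).

Lemma computable_cons n t (xs : nat -> n.-tuple term) :
  computable_term t -> computable_terms xs ->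
  computable_terms (fun x => cons_tuple (t x) (xs x)).
Proof.
move=> Ht Hxs i k; case: (unliftP ord0 i) => [j|] ->; last exact: Ht.
by have := Hxs j k; apply: computable1_ext => x; rewrite tnthS.
Qed.

Lemma computable_tshift n k (xs : nat -> n.-tuple term) :
  computable_terms xs -> computable_terms (fun x => tshift k (xs x)).
Proof.
move=> Hxs i j; have := computable_shift k (Hxs i) j.
by apply: computable1_ext => x; rewrite tnth_map.
Qed.

(** With [f] fixed the shape of the formula is fixed, and only the argument terms depend on [x]. *)
Lemma computable_graph n (f : recf n) b (xs : nat -> n.-tuple term) y :
  computable_term b -> computable_terms xs -> computable_term y ->
  computable_form (fun x => graph f (b x) (xs x) (y x)).
Proof.
have Z : computable_term (fun=> Zero) by move=> k; exact: computable_const.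
have V := computable_Var; have S := computable_shift.
elim: f b xs y => {n} /=.
- by move=> n b xs y _ _ Hy; exact: computable_Eq.
- move=> b xs y _ Hxs Hy; apply: computable_Eq => //.
  exact: (computable_Succ (Hxs ord0)).
- by move=> n i b xs y _ Hxs Hy; exact: computable_Eq.
- move=> n m f IHf gs IHg b xs y Hb Hxs Hy; apply: computable_bexn_le => //.
  apply: computable_And.
    apply: computable_bigAnd => i; apply: IHg => //; first exact: (S).
    exact: computable_tshift.
  apply: IHf => //; [exact: (S)| |exact: (S)].
  by move=> i k; rewrite tnth_mktuple; exact: V.
- move=> n f IHf g IHg b xs y Hb Hxs Hy.
  have Hk : computable_term (fun x => thead (xs x)) by exact: Hxs.
  have Hp : computable_terms (fun x => behead_tuple (xs x)).
    move=> i k; have := Hxs (inord i.+1) k; apply: computable1_ext => x.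
    by rewrite tnth_behead.
  apply: computable_bex_le => //; apply: computable_bex_le; first exact: (S).
  apply: computable_And.
    apply: computable_bex_le; first exact: (S).
    apply: computable_And; first exact: computable_beta.
    by apply: IHf => //; [exact: (S)|exact: computable_tshift].
  apply: computable_And; last by apply: computable_beta => //; exact: (S).
  apply: computable_ball_lt; first exact: (S).
  apply: computable_bex_le; first exact: (S).
  apply: computable_bex_le; first exact: (S).
  apply: computable_And; first exact: computable_beta.
  apply: computable_And.
    by apply: computable_beta => //; exact: computable_Succ.
  apply: IHg => //; first exact: (S).
  do 2 apply: computable_cons => //; exact: computable_tshift.
- move=> n f IHf b xs y Hb Hxs Hy; apply: computable_And.
    by apply: IHf => //; exact: computable_cons.
  apply: computable_ball_lt => //; apply: computable_bex_le; first exact: (S).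
  apply: IHf; [exact: (S)| |exact: computable_Succ].
  by apply: computable_cons => //; exact: computable_tshift.
Qed.

Lemma computable_halts e : computable_form (halts e).
Proof.
apply/computable_Ex/computable_bex_le; first exact: computable_Var.
apply: computable_graph; [exact: computable_Var| |exact: computable_Var].
have H : computable_terms (fun n => [tuple num n]).
  by move=> i; rewrite ord1; exact: computable_num.
exact: (computable_cons computable_num H).
Qed.

End Coding.

(** * Closedness of the halting formula *)

Lemma tbounded_shift j k t : tbounded j t -> tbounded (k + j) (shift k t).
Proof.
elim: t => //= [n|t IHt u IHu|t IHt u IHu]; first by rewrite ltn_add2l.
- by move=> /andP[/IHt -> /IHu ->].
- by move=> /andP[/IHt -> /IHu ->].
Qed.

Lemma bounded_fle k t u : tbounded k t -> tbounded k u -> bounded k (fle t u).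
Proof. by move=> Ht Hu /=; rewrite !(@tbounded_shift k 1). Qed.

Lemma bounded_ball_lt k t A :
  tbounded k t -> bounded k.+1 A -> bounded k (ball_lt t A).
Proof.
move=> Ht HA; rewrite /ball_lt [bounded _ _]/= -/(fle _ _) HA andbT.
by apply: (@bounded_fle k.+1 (Succ (Var 0))) => //; exact: tbounded_shift.
Qed.

Lemma bounded_bex_le k t A :
  tbounded k t -> bounded k.+1 A -> bounded k (bex_le t A).
Proof.
move=> Ht HA.
have := @bounded_fle k.+1 (Var 0) (shift 1 t) isT (@tbounded_shift k 1 t Ht).
by rewrite /bex_le /= => ->; rewrite HA.
Qed.

Lemma bounded_bexn_le k m t A :
  tbounded k t -> bounded (m + k) A -> bounded k (bexn_le m t A).
Proof.
elim: m k t => [|m IH] k t Ht HA //=; apply: bounded_bex_le => //.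
by apply: IH; [exact: tbounded_shift|rewrite addnS].
Qed.

Lemma bounded_And k A B : bounded k A -> bounded k B -> bounded k (And A B).
Proof. by move=> /= -> ->. Qed.

Lemma bounded_Ex k A : bounded k.+1 A -> bounded k (Ex A).
Proof. by move=> /= ->. Qed.

Lemma bounded_beta k a d i z : tbounded k a -> tbounded k d -> tbounded k i ->
  tbounded k z -> bounded k (beta a d i z).
Proof.
move=> Ha Hd Hi Hz; apply: bounded_And.
  by apply: bounded_fle; rewrite /= ?Hd ?Hi ?Hz.
apply: bounded_bex_le => //=.
by rewrite !(@tbounded_shift k 1).
Qed.

Lemma bounded_graph n (f : recf n) k b xs y : tbounded k b ->
  (forall i, tbounded k (tnth xs i)) -> tbounded k y -> bounded k (graph f b xs y).
Proof.
have S j i t : tbounded i t -> tbounded (j + i) (shift j t) := @tbounded_shift i j t.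
elim: f k b xs y => {n}.
- by move=> n k b xs y _ _ /= ->.
- by move=> k b xs y _ Hxs /= ->; exact: Hxs.
- by move=> n i k b xs y _ Hxs /= ->; exact: Hxs.
- move=> n m f IHf gs IHg k b xs y Hb Hxs Hy; apply: bounded_bexn_le => //.
  have Vi (i : 'I_m) : tbounded (m + k) (Var i).
    by rewrite /=; apply: leq_trans (leq_addr _ _).
  apply: bounded_And.
    elim/big_ind: _ => [//|A B|i _]; first exact: bounded_And.
    by apply: IHg => //; [exact: S|move=> j; rewrite tnth_map; exact: S].
  by apply: IHf; [exact: S|move=> i; rewrite tnth_mktuple|exact: S].
- move=> n f IHf g IHg k b xs y Hb Hxs Hy.
  have Hk : tbounded k (thead xs) by exact: Hxs.
  have Hp i : tbounded k (tnth (behead_tuple xs) i) by rewrite tnth_behead.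
  apply: bounded_bex_le => //; apply: bounded_bex_le; first exact: S.
  apply: bounded_And.
    apply: bounded_bex_le; first exact: (S 2).
    apply: bounded_And; first exact: bounded_beta.
    by apply: IHf => //; [exact: (S 3)|move=> i; rewrite tnth_map; exact: (S 3)].
  apply: bounded_And; last by apply: bounded_beta => //; exact: (S 2).
  apply: bounded_ball_lt; first exact: (S 2).
  apply: bounded_bex_le; first exact: (S 3).
  apply: bounded_bex_le; first exact: (S 4).
  apply: bounded_And; first exact: bounded_beta.
  apply: bounded_And; first exact: bounded_beta.
  apply: IHg => //; first exact: (S 5).
  move=> i; case: (unliftP ord0 i) => [j|] -> //; rewrite tnthS.
  by case: (unliftP ord0 j) => [l|] -> //; rewrite tnthS tnth_map; exact: (S 5).
- move=> n f IHf k b xs y Hb Hxs Hy; apply: bounded_And.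
    by apply: IHf => // i; case: (unliftP ord0 i) => [j|] -> //; rewrite tnthS.
  apply: bounded_ball_lt => //; apply: bounded_bex_le; first exact: S.
  apply: IHf => //; first exact: (S 2).
  move=> i; case: (unliftP ord0 i) => [j|] -> //; rewrite tnthS tnth_map.
  exact: (S 2).
Qed.

Lemma sentence_halts e n : sentence (halts e n).
Proof.
have num_closed k : tbounded k (num n) by elim: n => //=.
apply/bounded_Ex/bounded_bex_le => //; apply: bounded_graph => // i.
by case: (unliftP ord0 i) => [j|] -> //; rewrite tnthS ord1.
Qed.

(** * Deduction theorem, recursion theorem, and the theory U *)

Lemma deduction (T : form -> Prop) H A : sentence H ->
  provable (fun B => T B \/ B = H) A <-> provable T (Imp H A).
Proof.
move=> sH; split=> [|HA].
  elim=> {A}.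
  - move=> A [TA| ->]; last exact: (@ded_hyp T [:: H] 0).
    by apply: (@ded_lift T [:: H]); exact: PrAx.
  - by move=> *; apply: (@ded_lift T [:: H]); exact: PrK.
  - by move=> *; apply: (@ded_lift T [:: H]); exact: PrS.
  - by move=> *; apply: (@ded_lift T [:: H]); exact: PrDN.
  - by move=> *; apply: (@ded_lift T [:: H]); exact: PrInst.
  - by move=> *; apply: (@ded_lift T [:: H]); exact: PrDist.
  - by move=> *; apply: (@ded_lift T [:: H]); exact: PrVac.
  - by move=> *; apply: (@ded_lift T [:: H]); exact: PrRefl.
  - by move=> *; apply: (@ded_lift T [:: H]); exact: PrLeibniz.
  - by move=> A B _ IH1 _ IH2; exact: (@ded_mp T [:: H] A B).
  (* Generalization is where [H] must be a sentence: [H] equals its own shift, so [PrVac] yields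
     [Imp H (All H)]. *)
  - move=> A _ IH; apply: imp_trans (PrMP (PrDist T _ _) (PrGen IH)).
    by have := PrVac T H; rewrite /fshift (bounded_subst sH).
apply: (PrMP (A := H)); last by apply: PrAx; right.
by elim: HA => *; [apply: PrAx; left|exact: PrK|exact: PrS|exact: PrDN
  |exact: PrInst|exact: PrDist|exact: PrVac|exact: PrRefl|exact: PrLeibniz
  |apply: PrMP; eassumption|exact: PrGen].
Qed.

(** Kleene's argument: let [s(i)] be an index of the function sending [x] to [g(phi_i(i), x)], let
    [j] be an index of [s], and take [u = s(j)]. Then [phi_j(j) = u]. *)
Lemma recursion_theorem (e : recf 2) (g : recf 2) : acceptable e ->
  exists u, forall x y, phi e u x y <-> eval g [tuple u; x] y.
Proof.
move=> he.
pose p0 : 'I_2 := ord0; pose p1 : 'I_2 := lift ord0 ord0.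
pose f := RComp g (fun i : 'I_2 => if i == ord0 then RComp e (fun=> RProj p0)
                                   else RProj p1).
have [s Hs] := he f.
(* An index of [s] comes from acceptability for a function that ignores its first argument, fixed
   here at 0. *)
have [_ /(_ 0) [j [_ Hj]]] := he (RComp s (fun=> RProj p1)).
have {}Hj x y : phi e j x y <-> eval s [tuple x] y.
  rewrite Hj /=; split=> [[w [Hw]]|H].
    by rewrite (tuple1E w); have := Hw ord0; rewrite /thead /= => ->.
  by exists [tuple x]; split=> // i; rewrite ord1.
have [u [Hu Hphi]] := Hs j; exists u => x y; rewrite Hphi /=.
have self w : eval e [tuple j; j] w <-> w = u.
  by rewrite -/(phi e j j w) Hj; split=> [/eval_fun /(_ Hu)|->].
split=> [[w [Hw Hg]]|Hg].
  suff <- : w = [tuple u; x] by [].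
  have [w0 [Hw0 Hev]] := Hw p0.
  have E0 : w0 = [tuple j; j].
    apply: eq_from_tnth => i; rewrite Hw0.
    by case: (unliftP ord0 i) => [k|] ->; rewrite ?ord1.
  rewrite E0 in Hev; apply: eq_from_tnth => i; case: (unliftP ord0 i) => [k|] ->.
    by rewrite ord1; have := Hw p1.
  exact/self.
exists [tuple u; x]; split=> // i; case: (unliftP ord0 i) => [k|] ->.
  by rewrite ord1.
exists [tuple j; j]; split; last exact/self.
by move=> k; case: (unliftP ord0 k) => [l|] ->; rewrite ?ord1.
Qed.

(** Totality of [F] matters: minimization stops at the least zero because all earlier tests are
    defined and nonzero. *)
Lemma re_search n (F : n.+1.-tuple nat -> nat) : computable F ->
  exists g : recf n, forall v,
    (exists y, eval g v y) <-> exists w, F (cons_tuple w v) = 0.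
Proof.
move=> [f Hf]; exists (RMin f) => v /=.
split=> [[y [/Hf Hy _]]|[w Hw]]; first by exists y.
have ex : exists w, F (cons_tuple w v) == 0 by exists w; rewrite Hw.
exists (ex_minn ex); case: ex_minnP => m /eqP Hm Hmin; split.
  by apply/Hf; rewrite Hm.
move=> z Hz; exists (F (cons_tuple z v)).-1; apply/Hf; rewrite prednK // lt0n.
by apply: contraL Hz => /Hmin; rewrite -leqNgt.
Qed.

Lemma enum_re (h : nat -> nat) :
  computable1 h -> re (fun n => exists w, h w = n.+1).
Proof.
move=> Hh; pose i0 : 'I_2 := ord0; pose i1 : 'I_2 := lift ord0 ord0.
have H0 : computable (fun v : 2.-tuple nat => h (tnth v i0)).
  exact: computable1_comp Hh (computable_proj i0).
have H1 := computable_succ (computable_proj i1).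
have [g Hg] := re_search (computable_add (computable_sub H0 H1)
  (computable_sub H1 H0)).
exists g => n; rewrite Hg; split=> -[w Hw]; exists w; last first.
  by move: Hw; rewrite !(tnth_nth 0) /=; lia.
by rewrite !(tnth_nth 0) /= Hw subnn.
Qed.

Lemma re_theory_add (T : form -> Prop) H :
  re_theory T -> re_theory (fun B => T B \/ B = H).
Proof.
move=> /re_enum [h [Hh Th]].
(* The new axiom is listed at position 0, and the old enumeration is moved up by one. *)
have Hh' : computable1 (fun w => if w is k.+1 then h k else (fcode H).+1).
  apply: (@computable1_case id (fun=> (fcode H).+1) (fun k _ => h k)).
  - exact: computable1_id.
  - exact: computable_const.
  - exact: computable1_comp Hh (computable_cfst computable1_id).
have [f Hf] := enum_re Hh'; exists f => n; rewrite -Hf; split.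
  move=> [A [[TA|->] <-]]; last by exists 0.
  have [|w Hw] := (Th (fcode A)).1; first by exists A.
  by exists w.+1.
move=> [[[<-]|w Hw]]; first by exists H; split=> //; right.
have [|A [TA <-]] := (Th n).2; first by exists w.
by exists A; split=> //; left.
Qed.

Theorem theorem2p3 (e : recf 2) (he : acceptable e) (T : form -> Prop)
    (hT : theory T) (hTcons : consistent T) (hTre : re_theory T)
    (hTQ : subtheory Q T) :
  exists (U : form -> Prop) (u : nat),
    theory U /\ consistent U /\ re_theory U /\ subtheory T U /\
    (forall n : nat, W e u n <-> provable U (diverges e n)) /\
    provable U (halts e u) /\
    ~ W e u u.
Proof.
have [E [HE HTE]] := provable_enum hTre.
(* Abstracting [hc] keeps unification from unfolding [graph e]. *)
have [hc [Hhc hcE]] : exists hc,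
    computable1 hc /\ forall n, hc n = fcode (halts e n).
  exists (fun n => fcode (halts e n)).
  by split; [exact: (computable_halts e)|move=> n; reflexivity].
(* The judgement that T proves [Imp (halts e u) (diverges e n)], spelled out in pairs so that its
   computability is visible; [cpair 0 0] is the code of [Bot]. *)
pose goal u n := cpair 7 (cpair 2 (cpair (hc u)
  (cpair 2 (cpair (hc n) (cpair 0 0))))).
have goalE u n : goal u n = cpair 7 (fcode (Imp (halts e u) (diverges e n))).
  by rewrite /goal !hcE.
have Hgoal : computable (fun v : 3.-tuple nat =>
    goal (tnth v (lift ord0 ord0)) (tnth v (lift ord0 (lift ord0 ord0)))).
  have Hh i : computable (fun v : 3.-tuple nat => hc (tnth v i)).
    exact: computable1_comp Hhc (computable_proj i).
  have C k := computable_const 3 k.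
  by do 5 apply: computable_cpair => //; apply: computable_cpair.
have HEw : computable (fun v : 3.-tuple nat => E (tnth v ord0)).
  exact: computable1_comp HE (computable_proj _).
(* The arguments are a position [w], then [u] and [n]; the sum of differences is 0 exactly when
   position [w] lists the goal. *)
have [g Hg] := re_search (computable_add (computable_sub HEw Hgoal)
  (computable_sub Hgoal HEw)).
have [u Hu] := recursion_theorem g he.
pose U B := T B \/ B = halts e u.
have HW n : W e u n <-> provable U (diverges e n).
  rewrite /U deduction ?sentence_halts // HTE -goalE.
  transitivity (exists y, eval g [tuple u; n] y).
    by split=> -[y /Hu Hy]; exists y.
  rewrite Hg; split=> -[w Hw]; exists w.
    by move: Hw; rewrite !(tnth_nth 0) /=; lia.
  by rewrite !(tnth_nth 0) /= Hw subnn.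
have Hhalts : provable U (halts e u) by apply: PrAx; right.
have Ucons : consistent U.
  move=> Hbot; apply: hTcons.
  have Huu : W e u u by apply/HW; apply: PrMP Hbot; exact: PrK.
  move: Hbot; rewrite /U deduction ?sentence_halts // => Hneg.
  exact: PrMP Hneg (provable_halts hT hTQ Huu).
exists U, u; do 6?split=> //.
- by move=> A [/hT|->] //; exact: sentence_halts.
- exact: re_theory_add.
- by move=> A TA; left.
(* Convergence would put [u] into its own set, so U would refute its own axiom. *)
- by move=> /HW Hdiv; apply: Ucons; apply: PrMP Hdiv Hhalts.
Qed.
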